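(* Let $p\in[0,1)$ and $\rho<2/3$. There exist constants $c_7\in(0,1)$ and $c_8>0$ such that whenever $\alpha=m/n>c_7$ and $n$ is sufficiently large the following holds. Fix $T\subseteq\{1,\dots,n\}$ with $|T|\le\rho m$ and a sign pattern $\sigma\in\{-1,+1\}^T$. Then with probability at least $1-e^{-c_8n}$ an $m\times n$ matrix $A$ with i.i.d. $\mathcal N(0,1)$ entries has the property: every $\mathbf x\in\mathbb R^n$ with support $T$ and $\operatorname{sgn}(x_i)=\sigma_i$ for $i\in T$ is the unique solution of $\min\{\|\mathbf v\|_p^p:A\mathbf v=A\mathbf x\}$ (for $p=0$, of $\min\{\|\mathbf v\|_0:A\mathbf v=A\mathbf x\}$).
   Context: $\|\mathbf v\|_p^p=\sum_i|v_i|^p$ for $p>0$; $\|\mathbf v\|_0=|\{i:v_i\ne0\}|$. *)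

(* Defs.v *)
From HB Require Import structures.
From mathcomp Require Import all_boot all_order all_algebra.
From mathcomp Require Import all_classical all_reals all_analysis.
Set Implicit Arguments. Unset Strict Implicit. Unset Printing Implicit Defensive.
Import Order.TTheory GRing.Theory Num.Theory.
Import numFieldNormedType.Exports.
Local Open Scope classical_set_scope.
Local Open Scope ring_scope.

Definition lp_pow {R : realType} {n : nat} (p : R) (v : 'cV[R]_n) : R :=
  if p == 0 then (#|[set i : 'I_n | v i 0 != 0]|)%:R
  else \sum_(i < n) (`|v i 0| `^ p).

Definition unique_lp_minimizer {R : realType} {m n : nat} (p : R)
    (A : 'M[R]_(m, n)) (x : 'cV[R]_n) : Prop :=
  forall v : 'cV[R]_n, A *m v = A *m x -> v <> x -> lp_pow p x < lp_pow p v.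

(* mutual independence of a finite family of real random variables:
   product rule for every choice of Borel sets (choosing setT for some
   indices recovers every subfamily) *)
Definition mutually_independent {d : measure_display} {T : measurableType d}
    {R : realType} (P : probability T R) {I : finType} (X : I -> T -> R) : Prop :=
  forall B : I -> set R, (forall i, measurable (B i)) ->
    P (\bigcap_(i in [set: I]) (X i @^-1` B i)) =
    (\prod_(i : I) P (X i @^-1` B i))%E.

Definition std_gaussian {d : measure_display} {T : measurableType d}
    {R : realType} (P : probability T R) (X : T -> R) : Prop :=
  measurable_fun [set: T] X /\
  forall B : set R, measurable B -> P (X @^-1` B) = normal_prob 0 1 B.

Definition gauss_matrix {T : Type} {R : realType} {m n : nat}
    (G : 'I_m * 'I_n -> T -> R) (w : T) : 'M[R]_(m, n) :=
  \matrix_(i, j) G (i, j) w.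

(* Main.v *)
(* The failure of recovery for a fixed support T and fixed signs is the event
   that some z in the kernel of A satisfies
     sum over T with sign z_j = - sigma_j of |z_j|^p  >=  sum off T of |z_j|^p
   (for p < 1 the coordinates of T where z agrees with sigma cost nothing).
   For a fixed vector z, a uniformly random placement of T and of the signs makes
   the left side about |T| / (2n) and the right side about 1 - |T| / n of the
   whole sum, so 2/3 is the threshold, and deviations have probability exp(-cn)
   as soon as z is spread.

   The law of A is invariant under signed permutations of its columns, so the
   failure probability is an average over placements of T and signs.  For fixed
   A the kernel has dimension at most k n with k small when m/n is close to 1,
   hence a net of exp(c(k) n) points with c(k) -> 0, on which the union bound closes.  Replacing
   the uniform placement of T by independent colours is harmless since failure
   is monotone in T.

   That all kernel vectors are spread is shown with crude constants: rounding a
   kernel vector with k n small coordinates to a lattice of scale e, by an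
   unbiased rounding whose error only involves the Frobenius norm of A, yields a
   lattice vector with few nonzero coordinates and a small image; there are
   C^n e^{-(1 - 3k/4) n} such vectors and each has a small image with probability
   at most (C e)^m, which is negligible for small e. *)
Require Import Defs.
From HB Require Import structures.
From mathcomp Require Import all_boot all_order all_algebra all_fingroup.
From mathcomp Require Import all_classical all_reals all_analysis.
From mathcomp Require Import measurable_realfun ring lra.
Set Implicit Arguments.
Unset Strict Implicit.
Unset Printing Implicit Defensive.
Import Order.TTheory GRing.Theory Num.Theory.
Import numFieldNormedType.Exports.
Local Open Scope classical_set_scope.
Local Open Scope ring_scope.

(** * Independent Gaussian families *)

(** Failure is phrased through a profile [H] attached to the colour of a coordinate: [None] off the
    support, [Some] of a sign on it. Kernel vectors are normalised to squared norm n, so that being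
    spread means that most coordinates exceed a constant radius. For p = 0 the count is
    discontinuous and does not pass to nearby net points, so a Lipschitz function below it, cut off
    at that radius, takes its place. Both cases then fit the same abstract hypotheses on [H]. The
    constants could become circular: the precision of the net depends on the radius of spread, and
    the dimension of the kernel must be small compared with that precision. Spreadness is therefore
    used twice, at a level [kap] to bound the mean of the profile from below, and at a possibly much
    smaller level [ka] to bound the dimension; the constant c_7 comes from [ka]. The ratio m/n has
    no upper bound while the size of T is measured against m. Once m exceeds n by a constant factor
    the kernel is trivial with high probability, by the same rounding argument with full support
    allowed. *)

Definition boxes (R : realType) (I : Type) : set (set (I -> R)) :=
  [set A | exists2 B : I -> set R, (forall i, measurable (B i)) &
     A = [set x | forall i, B i (x i)]].

Arguments boxes R I : clear implicits.

(** The product sigma-algebra. Its generating boxes are stable under intersection, which is what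
    determines a law by its values on them. *)
Notation coords R I := (g_sigma_algebraType (boxes R I)).

Definition gaussian_family {d} {T : measurableType d} {R : realType}
    (P : probability T R) {I : finType} (G : I -> T -> R) :=
  mutually_independent P G /\ forall i, std_gaussian P (G i).

Section GaussianFamily.
Context {R : realType} {I : finType}.
Local Notation X := (coords R I).

Lemma measurable_coord (i : I) : measurable_fun [set: X] (fun x : X => x i).
Proof.
move=> _ B mB; rewrite setTI; apply: sub_sigma_algebra.
exists (fun j => if j == i then B else setT).
  by move=> j; case: ifP.
apply/seteqP; split => x /=.
  by move=> Bx j; case: eqP => // ->.
by move/(_ i); rewrite eqxx.
Qed.

Lemma measurable_coords d (T : measurableType d) (G : I -> T -> R) :
  (forall i, measurable_fun [set: T] (G i)) ->
  measurable_fun [set: T] (fun w => (G ^~ w) : X).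
Proof.
move=> mG; refine (@measurability _ _ T X setT _ (boxes R I) _ _) => //.
move=> _ [_ [B mB ->] <-]; rewrite setTI.
rewrite (_ : _ @^-1` _ = \bigcap_(i in [set: I]) (G i @^-1` B i)).
  apply: fin_bigcap_measurable => // i _.
  by rewrite -[_ @^-1` _]setTI; exact: mG.
by apply/seteqP; split => w /= h; [move=> i _; exact: h|move=> i; exact: h].
Qed.

Lemma gaussian_family_measurable d (T : measurableType d) (P : probability T R)
    (G : I -> T -> R) :
  gaussian_family P G -> measurable_fun [set: T] (fun w => (G ^~ w) : X).
Proof. by move=> gG; apply: measurable_coords => i; case: (gG.2 i). Qed.

Lemma gaussian_family_box d (T : measurableType d) (P : probability T R)
    (G : I -> T -> R) (B : I -> set R) :
  gaussian_family P G -> (forall i, measurable (B i)) ->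
  (P [set w | forall i, B i (G i w)] = \prod_(i : I) normal_prob 0 1 (B i))%E.
Proof.
move=> [indG stdG] mB.
rewrite (_ : [set w | _] = \bigcap_(i in [set: I]) (G i @^-1` B i)).
  by rewrite indG//; apply: eq_bigr => i _; case: (stdG i) => _; apply.
by apply/seteqP; split => w /= h; [move=> i _; exact: h|move=> i; exact: h].
Qed.

(** Two measures that agree on the boxes, a generating pi-system, are equal. The two families may
    live on different spaces, so a family can be traded for a resampled or a signed and permuted
    one. *)
Lemma gaussian_family_law d (T : measurableType d) (P : probability T R)
    (G : I -> T -> R) d' (T' : measurableType d') (P' : probability T' R)
    (G' : I -> T' -> R) (S : set X) :
  gaussian_family P G -> gaussian_family P' G' -> measurable S ->
  P [set w | S (G ^~ w)] = P' [set w | S (G' ^~ w)].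
Proof.
move=> gG gG' mS.
have mG := gaussian_family_measurable gG.
have mG' := gaussian_family_measurable gG'.
pose f : {mfun T >-> X} := HB.pack (fun w => (G ^~ w) : X)
  (isMeasurableFun.Build _ _ _ _ _ mG).
pose f' : {mfun T' >-> X} := HB.pack (fun w => (G' ^~ w) : X)
  (isMeasurableFun.Build _ _ _ _ _ mG').
have uniq := @measure_unique _ R X (boxes R I) (fun=> setT)
  _ _ _ _ (pushforward P f) (pushforward P' f').
refine (uniq _ _ _ _ mG mG' _ _ S mS).
- by [].
- move=> _ _ [B mB ->] [C mC ->]; exists (fun i => B i `&` C i).
    by move=> i; exact: measurableI.
  apply/seteqP; split => x /=; first by move=> [xB xC] i.
  by move=> xBC; split=> i; case: (xBC i).
- by move=> _; exists (fun=> setT) => //; apply/seteqP.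
- by rewrite bigcup_const.
- move=> _ [B mB ->]; rewrite /pushforward.
  have := gaussian_family_box gG mB; rewrite -(gaussian_family_box gG' mB).
  by apply.
- by move=> _; rewrite (@le_lt_trans _ _ (P setT))// ?probability_setT ?ltry.
Qed.

Lemma gaussian_family_integral d (T : measurableType d) (P : probability T R)
    (G : I -> T -> R) d' (T' : measurableType d') (P' : probability T' R)
    (G' : I -> T' -> R) (f : X -> \bar R) :
  gaussian_family P G -> gaussian_family P' G' ->
  measurable_fun [set: X] f -> (forall x, 0 <= f x)%E ->
  (\int[P]_w f (G ^~ w) = \int[P']_w f (G' ^~ w))%E.
Proof.
move=> gG gG' mf f0.
have mG := gaussian_family_measurable gG.
have mG' := gaussian_family_measurable gG'.
have := ge0_integral_pushforward mG P measurableT mf (fun y _ => f0 y).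
rewrite preimage_setT => <-.
have := ge0_integral_pushforward mG' P' measurableT mf (fun y _ => f0 y).
rewrite preimage_setT => <-.
apply: eq_measure_integral => A mA _.
exact: gaussian_family_law.
Qed.

(** Entry [i] is redrawn on a second factor; the law of the family is unchanged, and Fubini can then
    isolate this entry. *)
Definition resample {T : Type} (G : I -> T -> R) (i : I) :
    I -> (T * measurableTypeR R -> R) := fun k z => if k == i then z.2 else G k z.1.

Lemma gaussian_family_resample d (T : measurableType d) (P : probability T R)
    (G : I -> T -> R) (i : I) :
  gaussian_family P G ->
  gaussian_family (P \x (normal_prob 0 1 : probability (measurableTypeR R) R))%E (resample G i).
Proof.
move=> gG.
have boxE (B : I -> set R) : (forall k, measurable (B k)) ->
   ((P \x (normal_prob 0 1 : probability (measurableTypeR R) R))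
     (\bigcap_(k in [set: I]) (resample G i k @^-1` B k)) =
    \prod_(k : I) normal_prob 0 1 (B k))%E.
  move=> mB.
  (* The constraint on entry [i] is carried by the second factor, so it is lifted on the first
     one. *)
  pose C := fun k => if k == i then [set: R] else B k.
  have mC k : measurable (C k) by rewrite /C; case: ifP.
  rewrite (_ : \bigcap_(k in _) _ = [set w | forall k, C k (G k w)] `*` B i).
    have mGC : measurable [set w | forall k, C k (G k w)].
      rewrite (_ : [set w | _] = \bigcap_(k in [set: I]) (G k @^-1` C k)).
        apply: fin_bigcap_measurable => // k _.
        by rewrite -[_ @^-1` _]setTI; apply: (gG.2 k).1.
      by apply/seteqP; split => w /= h; [move=> k _; exact: h|move=> k; exact: h].
    rewrite product_measure1E//; last exact: mB.
    transitivity (\prod_k normal_prob 0 1 (C k) * normal_prob 0 1 (B i))%E.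
      by congr (_ * _)%E; exact: gaussian_family_box.
    rewrite (bigD1 i)//= [in RHS](bigD1 i)//=.
    rewrite {1}/C eqxx probability_setT mul1e muleC; congr (_ * _)%E.
    by apply: eq_bigr => k /negbTE; rewrite /C => ->.
  apply/seteqP; split => [[w y]|[w y] [/=]] h.
    split => /=; last by have := h i Logic.I; rewrite /resample/= eqxx.
    move=> k; have := h k Logic.I; rewrite /resample/= /C.
    by case: eqP.
  by move=> By k _; rewrite /resample/=; have := h k; rewrite /C; case: eqP => // ->.
have margE k B : measurable B ->
    ((P \x (normal_prob 0 1 : probability (measurableTypeR R) R)) (resample G i k @^-1` B) =
    normal_prob 0 1 B)%E.
  move=> mB; pose C := fun j => if j == k then B else [set: R].
  have mC j : measurable (C j) by rewrite /C; case: ifP.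
  rewrite (_ : resample G i k @^-1` B =
     \bigcap_(j in [set: I]) (resample G i j @^-1` C j)); last first.
    apply/seteqP; split => w /=; first by move=> h j _ /=; rewrite /C; case: eqP => // ->.
    by move/(_ k Logic.I); rewrite /= /C eqxx.
  refine (etrans (boxE C mC) _); rewrite (bigD1 k)//= {1}/C eqxx big1 ?mule1// => j /negbTE.
  by rewrite /C => ->; rewrite probability_setT.
split.
  move=> B mB; refine (etrans (boxE B mB) _).
  by apply: eq_bigr => k _; exact/esym/margE.
move=> k; split; last exact: margE.
rewrite /resample; case: (k == i); first exact: measurable_snd.
by apply: measurableT_comp => //; exact: (gG.2 k).1.
Qed.

Lemma gaussian_family_integrate d (T : measurableType d) (P : probability T R)
    (G : I -> T -> R) (i : I) (f : X -> \bar R) :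
  gaussian_family P G -> measurable_fun [set: X] f -> (forall x, 0 <= f x)%E ->
  (\int[P]_w f (G ^~ w) = \int[P]_w \int[normal_prob 0 1]_y
     f (fun k => if k == i then y else G k w))%E.
Proof.
move=> gG mf f0.
have gG' := gaussian_family_resample i gG.
rewrite (gaussian_family_integral gG gG')//.
have mf' : measurable_fun setT (fun z : T * measurableTypeR R => f (resample G i ^~ z)).
  refine (@measurableT_comp _ _ _ _ X _ f _
    (fun z => resample G i ^~ z) mf _).
  by apply: measurable_coords => k; case: (gG'.2 k).
refine (etrans (fubini_tonelli1 (fun z => f (resample G i ^~ z)) mf' _) _).
  by move=> z; exact: f0.
by apply: eq_integral.
Qed.

End GaussianFamily.

(** * Gaussian integrals, Chernoff bound and exponential moments *)

Section Density.
Local Open Scope ereal_scope.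
Context d (T : measurableType d) (R : realType).
Variables (mu nu : {measure set T -> \bar R}) (g : T -> R).
Hypotheses (mg : measurable_fun setT g) (g0 : forall x, (0 <= g x)%R).
Hypothesis nuE : forall A, measurable A -> nu A = \int[mu]_(x in A) (g x)%:E.

Import HBNNSimple.

Let density_nnsfun (f : {nnsfun T >-> R}) :
  \int[nu]_x (f x)%:E = \int[mu]_x ((f x)%:E * (g x)%:E).
Proof.
under [LHS]eq_integral do rewrite fimfunE -fsumEFin//.
rewrite [LHS]ge0_integral_fsum//; last 2 first.
  - by move=> r; exact/measurable_EFinP/measurableT_comp.
  - by move=> n x _; rewrite EFinM nnfun_muleindic_ge0.
under [RHS]eq_integral.
  move=> x xD; rewrite fimfunE -fsumEFin// ge0_mule_fsuml; last first.
    by move=> r; rewrite EFinM nnfun_muleindic_ge0.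
  over.
rewrite [RHS]ge0_integral_fsum//; last 2 first.
  - move=> r; apply: emeasurable_funM; last exact/measurable_EFinP.
    by apply/measurable_EFinP; apply/measurableT_comp.
  - by move=> n x _; apply: mule_ge0; [rewrite EFinM nnfun_muleindic_ge0|rewrite lee_fin].
apply: eq_fsbigr => r rf.
under [LHS]eq_integral do rewrite EFinM.
rewrite integralZl_indic_nnsfun// integral_indic//= setIT nuE//.
under [RHS]eq_integral do rewrite EFinM -muleA.
rewrite ge0_integralZl//.
- congr (_ * _); rewrite integral_mkcond/=.
  apply: eq_integral => x _; rewrite patchE indicE; case: ifPn => _.
    by rewrite mul1e.
  by rewrite mul0e.
- apply: emeasurable_funM; last exact/measurable_EFinP.
  exact/measurable_EFinP.
- by move=> x _; rewrite mule_ge0// lee_fin.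
- by move: rf; rewrite inE => -[x _ <-]; rewrite lee_fin.
Qed.

(** The assumption [nuE] only concerns sets; simple functions and monotone convergence extend it to
    integrands. *)
Lemma integral_density (f : T -> \bar R) :
  measurable_fun setT f -> (forall x, 0 <= f x) ->
  \int[nu]_x f x = \int[mu]_x (f x * (g x)%:E).
Proof.
move=> mf f0; pose f_ := nnsfun_approx measurableT mf.
transitivity (lim (\int[nu]_x (f_ n x)%:E @[n --> \oo])).
  rewrite -monotone_convergence//=.
  - apply: eq_integral => ? /[!inE] xD; apply/esym/cvg_lim => //=.
    exact: cvg_nnsfun_approx.
  - by move=> n; exact/measurable_EFinP/measurable_funTS.
  - by move=> n ? _; rewrite lee_fin.
  - by move=> ? _ ? ? mn; rewrite lee_fin; exact/lefP/nd_nnsfun_approx.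
rewrite [RHS](_ : _ = lim
    (\int[mu]_x ((f_ n x)%:E * (g x)%:E) @[n --> \oo])).
  by apply: congr_lim; apply/funext => n /=; exact: density_nnsfun.
rewrite -monotone_convergence//=.
- apply: eq_integral => ? /[!inE] xD; apply/esym/cvg_lim => //.
  by apply: cvgeZr => //; exact: cvg_nnsfun_approx.
- move=> n; apply: emeasurable_funM; last exact/measurable_EFinP.
  exact/measurable_EFinP/measurable_funTS.
- by move=> n ? _; rewrite mule_ge0 ?lee_fin.
- move=> ? _ ? ? mn; rewrite lee_wpmul2r ?lee_fin//.
  exact/lefP/nd_nnsfun_approx.
Qed.

End Density.

Section GaussianIntegral.
Context {R : realType}.

Local Notation N01 := (normal_prob 0 1 : probability (measurableTypeR R) R).

Lemma normal_prob_integral (f : R -> R) :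
  measurable_fun setT f -> (forall x, 0 <= f x) ->
  (\int[N01]_x (f x)%:E =
   \int[lebesgue_measure]_x (f x * normal_pdf 0 1 x)%:E)%E.
Proof.
move=> mf f0.
rewrite (@integral_density _ _ _ lebesgue_measure _ (normal_pdf 0 1))//.
- exact: measurable_normal_pdf.
- by move=> x; exact: normal_pdf_ge0.
- exact/measurable_EFinP.
Qed.

Lemma measurable_expR_sqr (l a b : R) :
  measurable_fun [set: measurableTypeR R]
    (fun x => expR (l * (a * x + b) ^+ 2)).
Proof.
apply: measurableT_comp => //.
apply: (@measurable_funM _ _ R setT (cst l) (fun x => (a * x + b) ^+ 2)) => //.
apply: (@measurable_funX _ _ R setT (fun x => a * x + b)).
apply: (@measurable_funD _ _ R setT (fun x => a * x) (cst b)) => //.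
exact: (@measurable_funM _ _ R setT (cst a) id).
Qed.

(* Completing the square turns the integrand into a multiple of the density of
   a normal law of variance [1 / (1 + 2 l a^2)]. *)
Lemma normal_integral_expR_sqr (l a b : R) : 0 < 1 + 2 * l * a ^+ 2 ->
  (\int[N01]_x (expR (- l * (a * x + b) ^+ 2))%:E =
   ((Num.sqrt (1 + 2 * l * a ^+ 2))^-1 *
     expR (- (l / (1 + 2 * l * a ^+ 2)) * b ^+ 2))%:E)%E.
Proof.
set D := 1 + 2 * l * a ^+ 2 => D0.
have sD0 : 0 < Num.sqrt D by rewrite sqrtr_gt0.
have sDD : Num.sqrt D ^+ 2 = D by rewrite sqr_sqrtr// ltW.
rewrite normal_prob_integral//; last first.
  exact: measurable_expR_sqr.
pose s := (Num.sqrt D)^-1; have s0 : s != 0 by rewrite gt_eqF ?invr_gt0.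
pose m := - (2 * l * a * b / D).
transitivity (\int[lebesgue_measure]_x ((s *
     expR (- (l / D) * b ^+ 2))%:E * (normal_pdf m s x)%:E))%E; last first.
  rewrite ge0_integralZl//=.
  - by rewrite integral_normal_pdf mule1.
  - by apply/measurable_EFinP; exact: measurable_normal_pdf.
  - by move=> x _; rewrite lee_fin normal_pdf_ge0.
  - by rewrite lee_fin mulr_ge0 ?expR_ge0// invr_ge0 ltW.
apply: eq_integral => x _; rewrite -EFinM; congr (_%:E).
rewrite normal_pdfE ?oner_eq0// normal_pdfE//.
rewrite /normal_fun.
have -> : normal_peak s = (Num.sqrt D) * normal_peak 1.
  rewrite /normal_peak /s exprVn sDD expr1n mul1r -mulrnAr sqrtrM ?invr_ge0 ?ltW//.
  by rewrite sqrtrV ?ltW// invfM invrK.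
rewrite mulrCA -!mulrA (mulrCA s) (mulrA s).
rewrite mulVf ?gt_eqF// mul1r.
rewrite [in RHS]mulrCA; congr (_ * _); rewrite -!expRD; congr expR.
rewrite subr0 expr1n /s exprVn sDD /m.
have D1 : D != 0 by rewrite gt_eqF.
have E : l * a ^+ 2 = (D - 1) / 2 by rewrite /D; field.
rewrite !mulNr -mulr_natr.
have -> : l * (a * x + b) ^+ 2 = l * a ^+ 2 * x ^+ 2 + 2 * l * a * b * x + l * b ^+ 2.
  by ring.
have -> : l / D * b ^+ 2 = l * b ^+ 2 - (2 * l * a * b) ^+ 2 / D / 2.
  rewrite [(2 * l * a * b) ^+ 2](_ : _ = 4 * (l * a ^+ 2) * (l * b ^+ 2)); last by ring.
  by rewrite E; field.
by rewrite E; field.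
Qed.

End GaussianIntegral.

(** Markov's inequality for [expR (- h)]. It bounds lower tails; an upper tail is reached by
    negating the variable. *)
Lemma chernoff d (T : measurableType d) (R : realType) (P : probability T R)
    (h : T -> R) (t : R) : measurable_fun setT h ->
  (P [set w | (h w <= t)%R] <= (expR t)%:E * \int[P]_w (expR (- h w))%:E)%E.
Proof.
move=> mh.
have mE : measurable_fun setT (fun w => (expR (- h w))%:E).
  apply/measurable_EFinP; apply: measurableT_comp => //.
  exact: measurableT_comp.
have mA : measurable [set w | h w <= t].
  rewrite -[X in measurable X]setTI; apply: measurable_fun_le => //.
rewrite -ge0_integralZl//.
rewrite -[X in (P X <= _)%E]setIT -integral_indic//.
apply: ge0_le_integral => //.
- exact/measurable_EFinP/measurable_indic.
- by apply: emeasurable_funM.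
- move=> w _; rewrite indicE -EFinM lee_fin -expRD.
  case: (boolP (w \in _)) => [|_]; last exact: expR_ge0.
  by rewrite inE/= => hw; rewrite -[leLHS]expR0 ler_expR subr_ge0.
Qed.

Section GaussianMoments.
Context {R : realType}.

(** One entry is integrated out at a time, each giving the factor E exp(X^2/4) = sqrt 2. *)
Lemma gaussian_family_expR_sum_sqr (I : finType) d (T : measurableType d)
    (P : probability T R) (G : I -> T -> R) (S : {set I}) :
  gaussian_family P G ->
  (\int[P]_w (expR (\sum_(k in S) G k w ^+ 2 / 4))%:E =
   (Num.sqrt 2 ^+ #|S|)%:E)%E.
Proof.
move=> gG; have [s] := ubnP #|S|; elim: s S => // s IH S Ss.
have [->|[i iS]] := set_0Vmem S.
  under eq_integral do rewrite big_set0 expR0.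
  by rewrite cards0 expr0 integral_cst//= mul1e probability_setT.
have mf (U : {set I}) : measurable_fun [set: coords R I]
    (fun x => (expR (\sum_(k in U) x k ^+ 2 / 4))%:E).
  apply/measurable_EFinP; apply: measurableT_comp => //.
  rewrite (_ : (fun x => _) = (fun x : coords R I =>
    \sum_k (if k \in U then x k ^+ 2 / 4 else 0))); last first.
    by apply/funext => x; rewrite big_mkcond.
  apply: measurable_sum => k; case: (k \in U) => //.
  apply: (@measurable_funM _ (coords R I) R setT (fun x => x k ^+ 2) (cst 4^-1)) => //.
  apply: (@measurable_funX _ (coords R I) R setT (fun x => x k)).
  exact: measurable_coord.
rewrite (gaussian_family_integrate i gG (mf S)); last first.
  by move=> x; rewrite lee_fin expR_ge0.
under eq_integral => w _.
  have -> : (\int[normal_prob 0 1]_y (expR (\sum_(k in S)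
      (if k == i then y else G k w) ^+ 2 / 4))%:E =
    \int[(normal_prob 0 1 : probability (measurableTypeR R) R)]_y
      ((expR (\sum_(k in S :\ i) G k w ^+ 2 / 4))%:E *
       (expR (- (- 4^-1) * (1 * y + 0) ^+ 2))%:E))%E.
    apply: eq_integral => y _; rewrite -EFinM -expRD; congr (expR _)%:E.
    rewrite (big_setD1 i)//= eqxx addrC; congr (_ + _).
      by apply: eq_bigr => k; rewrite !inE => /andP[/negbTE ->].
    by rewrite opprK mul1r addr0 mulrC.
  rewrite ge0_integralZl//; last first.
    by apply/measurable_EFinP; exact: measurable_expR_sqr.
  rewrite normal_integral_expR_sqr; last by lra.
  over.
have -> : (Num.sqrt (1 + 2 * (- 4^-1) * 1 ^+ 2))^-1 *
    expR (- (- 4^-1 / (1 + 2 * (- 4^-1) * 1 ^+ 2)) * 0 ^+ 2) = Num.sqrt 2 :> R.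
  rewrite expr0n/= mulr0 expR0 mulr1 expr1n.
  rewrite (_ : 1 + _ = 2^-1); last by lra.
  by rewrite sqrtrV// invrK.
rewrite ge0_integralZr//.
- have Si : #|S| = #|S :\ i|.+1 by rewrite (cardsD1 i) iS.
  rewrite IH; last by rewrite Si in Ss.
  by rewrite Si exprSr.
- have mG := gaussian_family_measurable gG.
  refine (@measurableT_comp _ _ _ _ (coords R I) _ _ _ _ (mf (S :\ i)) mG).
Qed.

Lemma measurable_quad m n (l : 'I_m -> R) (a : 'I_m * 'I_n -> R) :
  measurable_fun [set: coords R ('I_m * 'I_n)%type]
    (fun x => \sum_i l i * (\sum_k a (i, k) * x (i, k)) ^+ 2).
Proof.
apply: measurable_sum => i.
apply: (@measurable_funM _ _ R setT (cst (l i))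
  (fun x : coords R ('I_m * 'I_n)%type => (\sum_k a (i, k) * x (i, k)) ^+ 2)) => //.
apply: (@measurable_funX _ _ R setT
  (fun x : coords R ('I_m * 'I_n)%type => (\sum_k a (i, k) * x (i, k)))).
apply: measurable_sum => k.
apply: (@measurable_funM _ _ R setT (cst (a (i, k)))
  (fun x : coords R ('I_m * 'I_n)%type => x (i, k))) => //.
exact: measurable_coord.
Qed.

(** Integrating out one entry leaves an integrand of the same shape, with that coefficient set to 0
    and the weight [l] of its row divided by [D]. The weights depend on the row so that this
    induction on the number of nonzero coefficients closes. *)
Lemma gaussian_family_expR_quad m n d (T : measurableType d)
    (P : probability T R) (G : 'I_m * 'I_n -> T -> R)
    (l : 'I_m -> R) (a : 'I_m * 'I_n -> R) :
  gaussian_family P G -> (forall i, 0 <= l i) ->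
  (\int[P]_w (expR (- \sum_i l i * (\sum_k a (i, k) * G (i, k) w) ^+ 2))%:E =
   (\prod_i (Num.sqrt (1 + 2 * l i * \sum_k a (i, k) ^+ 2))^-1)%:E)%E.
Proof.
move=> gG.
have mf (l1 : 'I_m -> R) (a1 : 'I_m * 'I_n -> R) :
    measurable_fun [set: coords R ('I_m * 'I_n)%type]
    (fun x => (expR (- \sum_i l1 i * (\sum_k a1 (i, k) * x (i, k)) ^+ 2))%:E).
  apply/measurable_EFinP; apply: measurableT_comp => //.
  apply: measurableT_comp => //; exact: measurable_quad.
have [s] := ubnP #|[set ik | a ik != 0]%SET|; elim: s l a => // s IH l a Ss l0.
have [S0|[[i0 k0]]] := set_0Vmem [set ik | a ik != 0]%SET.
  have a0 ik : a ik = 0.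
    apply/eqP/negPn/negP => h; have : ik \in [set ik | a ik != 0]%SET by rewrite inE.
    by rewrite S0 inE.
  under eq_integral => w _.
    rewrite big1 ?oppr0 ?expR0; last first.
      by move=> i _; rewrite big1 ?expr0n ?mulr0// => k _; rewrite a0 mul0r.
    over.
  rewrite integral_cst//= mul1e probability_setT big1// => i _.
  rewrite big1 ?mulr0 ?addr0 ?sqrtr1 ?invr1// => k _.
  by rewrite a0 expr0n.
rewrite inE => a0.
pose D := 1 + 2 * l i0 * a (i0, k0) ^+ 2.
have D1 : 1 <= D by rewrite lerDl mulr_ge0 ?sqr_ge0// mulr_ge0.
have D0 : 0 < D by exact: lt_le_trans D1.
pose a' ik := if ik == (i0, k0) then 0 else a ik.
pose l' i := if i == i0 then l i0 / D else l i.
have l'0 i : 0 <= l' i by rewrite /l'; case: ifP => // _; rewrite divr_ge0// ltW.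
rewrite (gaussian_family_integrate (i0, k0) gG (mf l a)); last first.
  by move=> x; rewrite lee_fin expR_ge0.
under eq_integral => w _.
  pose b := \sum_(k | k != k0) a (i0, k) * G (i0, k) w.
  pose rest := \sum_(i | i != i0) l i * (\sum_k a (i, k) * G (i, k) w) ^+ 2.
  have -> : (\int[normal_prob 0 1]_y (expR (- \sum_i l i * (\sum_k a (i, k) *
      (if (i, k) == (i0, k0) then y else G (i, k) w)) ^+ 2))%:E =
    \int[(normal_prob 0 1 : probability (measurableTypeR R) R)]_y
      ((expR (- rest))%:E *
       (expR (- l i0 * (a (i0, k0) * y + b) ^+ 2))%:E))%E.
    apply: eq_integral => y _; rewrite -EFinM -expRD; congr (expR _)%:E.
    rewrite (bigD1 i0)//= opprD addrC mulNr; congr (- _ - _).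
      apply: eq_bigr => i /negbTE ii0; congr (_ * _ ^+ 2).
      by apply: eq_bigr => k _; rewrite xpair_eqE ii0.
    congr (_ * _ ^+ 2); rewrite (bigD1 k0)//= eqxx; congr (_ + _).
    by apply: eq_bigr => k /negbTE kk0; rewrite xpair_eqE kk0 andbF.
  rewrite ge0_integralZl//; last first.
    by apply/measurable_EFinP; exact: measurable_expR_sqr.
  rewrite normal_integral_expR_sqr// -/D.
  have -> : ((expR (- rest))%:E * ((Num.sqrt D)^-1 *
        expR (- (l i0 / D) * b ^+ 2))%:E =
      ((Num.sqrt D)^-1)%:E * (expR (- \sum_i l' i *
        (\sum_k a' (i, k) * G (i, k) w) ^+ 2))%:E)%E.
      rewrite -!EFinM mulrCA -expRD; congr (_ * expR _)%:E.
      rewrite [in RHS](bigD1 i0)//= opprD addrC mulNr; congr (- _ - _).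
        rewrite /l' eqxx; congr (_ * _ ^+ 2); rewrite [in RHS](bigD1 k0)//=.
        rewrite /a' eqxx mul0r add0r; apply: eq_bigr => k /negbTE kk0.
        by rewrite xpair_eqE kk0 andbF.
      apply: eq_bigr => i /negbTE ii0; rewrite /l' ii0; congr (_ * _ ^+ 2).
      by apply: eq_bigr => k _; rewrite /a' xpair_eqE ii0.
    over.
rewrite ge0_integralZl//; last first.
  have mG := gaussian_family_measurable gG.
  refine (@measurableT_comp _ _ _ _ (coords R ('I_m * 'I_n)%type) _ _ _ _ (mf l' a') mG).
rewrite IH//; last first.
  rewrite -ltnS; apply: leq_trans Ss; rewrite ltnS; apply: proper_card.
  apply/properP; split.
    by apply/fintype.subsetP => ik; rewrite !inE /a'; case: ifP => //; rewrite eqxx.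
  by exists (i0, k0); rewrite !inE// /a' eqxx eqxx.
rewrite -EFinM; congr (_%:E); rewrite (bigD1 i0)//= [RHS](bigD1 i0)//= mulrA.
congr (_ * _); last first.
  apply: eq_bigr => i /negbTE ii0; rewrite /l' ii0; congr ((Num.sqrt (1 + _ * _))^-1).
  by apply: eq_bigr => k _; rewrite /a' xpair_eqE ii0.
(* The factors recombine because D (1 + 2 (l/D) S) = D + 2 l S, where S sums the remaining squares
   of the row. *)
rewrite -invfM -sqrtrM ?ltW//; congr ((Num.sqrt _)^-1).
rewrite /l' eqxx (bigD1 k0)//= [in RHS](bigD1 k0)//= /a' eqxx expr0n/= add0r.
have -> : \sum_(k | k != k0) (if (i0, k) == (i0, k0) then 0 else a (i0, k)) ^+ 2 =
          \sum_(k | k != k0) a (i0, k) ^+ 2.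
  by apply: eq_bigr => k /negbTE kk0; rewrite xpair_eqE kk0 andbF.
rewrite /D; set A := a _ ^+ 2; set B := \sum_(_ | _) _.
by field; rewrite gt_eqF.
Qed.

End GaussianMoments.

(** * Lattice points, weighted colourings and rounding *)

Section LatticeCount.
Context {R : realType}.

Lemma sum_expRN_le (N : nat) (a : R) : 0 < a ->
  \sum_(i < N) expR (- a * i.+1%:R) <= a^-1.
Proof.
move=> a0.
suff H : a * \sum_(i < N) expR (- a * i.+1%:R) <= 1 - expR (- a * N%:R).
  rewrite -(ler_pM2l a0) divff ?gt_eqF//; apply: le_trans H _.
  by rewrite lerBlDr lerDl expR_ge0.
elim: N => [|N IH]; first by rewrite big_ord0 !mulr0 expR0 subrr.
rewrite big_ord_recr/= mulrDr.
have : a * expR (- a * N.+1%:R) <= expR (- a * N%:R) - expR (- a * N.+1%:R).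
  have -> : expR (- a * N%:R) = expR (- a * N.+1%:R) * expR a.
    by rewrite -expRD; congr expR; rewrite -[N.+1]addn1 natrD; ring.
  rewrite -[X in _ <= _ - X]mulr1 -mulrBr mulrC ler_wpM2l ?expR_ge0//.
  by rewrite lerBrDl expR_ge1Dx.
by move: IH; set S := \sum_(i < N) _; lra.
Qed.

Lemma expr4_le_expR (k : nat) : 4 ^+ k <= expR 2 ^+ k :> R.
Proof.
apply: lerXn2r; rewrite ?nnegrE ?expR_ge0//.
rewrite (_ : 2 = 1 + 1) ?expRD; last by lra.
rewrite (_ : 4 = (1 + 1) * (1 + 1)); last by lra.
by apply: ler_pM => //; exact: expR_ge1Dx.
Qed.

(** A Chernoff bound for counting: weigh v by exp(-a |v|_1) Y^(- number of nonzero entries). Each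
    counted v weighs at least exp(-a B) Y^(-s), and the total weight is a product of n factors of
    size at most 2 (1 + 1/(a Y)), hence at most 4; the 2 comes from the sign bit. *)
Lemma lattice_count n N s (a Y B : R) : 0 < a -> 1 <= Y -> a^-1 <= Y ->
  \sum_(v : {ffun 'I_n -> 'I_N.+1 * bool} |
      (\sum_i ((v i).1 : nat)%:R <= B) &&
      (#|[set i | ((v i).1 : nat) != 0%N]%SET| <= s)%N) 1 <=
    expR (a * B) * 4 ^+ n * Y ^+ s.
Proof.
move=> a0 Y1 aY.
have Y0 : 0 < Y by exact: lt_le_trans Y1.
pose F (x : 'I_N.+1 * bool) : R :=
  expR (- a * (x.1 : nat)%:R) * (if (x.1 : nat) != 0%N then Y^-1 else 1).
have F0 x : 0 <= F x.
  by rewrite /F mulr_ge0 ?expR_ge0//; case: ifP => // _; rewrite invr_ge0 ltW.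
have SF : \sum_x F x <= 4.
  rewrite -(pair_big xpredT xpredT (fun k b => F (k, b)))/=.
  rewrite (eq_bigr (fun k : 'I_N.+1 => 2 * F (k, true))); last first.
    by move=> k _; rewrite big_bool /F/=; ring.
  rewrite -mulr_sumr big_ord_recl {1}/F/= mulr0 expR0 mul1r.
  rewrite (eq_bigr (fun i : 'I_N => Y^-1 * expR (- a * i.+1%:R))); last first.
    by move=> i _; rewrite /F/= mulrC.
  rewrite -mulr_sumr.
  have : Y^-1 * \sum_(i < N) expR (- a * i.+1%:R) <= 1.
    rewrite mulrC ler_pdivrMr// mul1r.
    exact: le_trans (sum_expRN_le N a0) aY.
  by lra.
apply: (@le_trans _ _ (\sum_(v : {ffun 'I_n -> 'I_N.+1 * bool})
    expR (a * B) * Y ^+ s * \prod_i F (v i))).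
  rewrite big_mkcond/=; apply: ler_sum => v _.
  case: ifP => [/andP[hB hs]|_]; last first.
    by rewrite !mulr_ge0 ?expR_ge0 ?exprn_ge0 ?(ltW Y0)//; exact: prodr_ge0.
  rewrite /F big_split/= -expR_sum -mulr_sumr -big_mkcond/=.
  rewrite prodr_const.
  have -> : #|[pred i | ((v i).1 : nat) != 0%N]| =
            #|[set i | ((v i).1 : nat) != 0%N]%SET|.
    by apply: eq_card => i; rewrite !inE.
  set q := #|_|; set S := \sum_i _.
  have -> : expR (a * B) * Y ^+ s * (expR (- a * S) * Y^-1 ^+ q) =
     expR (a * (B - S)) * Y ^+ (s - q).
    rewrite mulrACA -expRD; congr (expR _ * _); first by ring.
    by rewrite exprVn expfB_cond// gt_eqF.
  rewrite mulr_ege1 ?exprn_ege1// -[leLHS]expR0 ler_expR.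
  by rewrite mulr_ge0 ?(ltW a0)// subr_ge0.
rewrite -mulr_sumr [leRHS]mulrAC ler_wpM2l ?mulr_ge0 ?expR_ge0 ?exprn_ge0 ?(ltW Y0)//.
rewrite -(bigA_distr_bigA (fun _ x => F x)) prodr_const card_ord.
by apply: lerXn2r; rewrite ?nnegrE ?sumr_ge0.
Qed.

End LatticeCount.

Section WeightedColours.
Context {R : realType}.

(** Since exp(-y) >= 1 - y, exp y is at most 1/(1 - y), and (1 + y + 2 y^2)(1 - y) = 1 + y^2 (1 - 2
    y). *)
Lemma expR_le_quadratic (y : R) : y <= 2^-1 -> expR y <= 1 + y + 2 * y ^+ 2.
Proof.
move=> y2.
have h : 0 < 1 - y by lra.
have : (1 - y) * expR y <= 1.
  rewrite -[leRHS]expR0 -(addNr y) expRD mulrC [leRHS]mulrC.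
  by rewrite ler_wpM2l ?expR_ge0// expR_ge1Dx.
rewrite mulrC -ler_pdivlMr// mul1r => /le_trans; apply.
rewrite -div1r ler_pdivrMr//.
have -> : (1 + y + 2 * y ^+ 2) * (1 - y) = 1 + y ^+ 2 * (1 - 2 * y) by ring.
by rewrite lerDl mulr_ge0 ?sqr_ge0//; lra.
Qed.

(** For l b up to 1/2 the quadratic bound applies. Beyond that the crude bound exp(l b) is enough,
    since 4 (l b)^2 is then at least 2 l b while l times the mean is at most l b. *)
Lemma weighted_expR_le (C : finType) (w H : C -> R) (b l : R) :
  (forall c, 0 <= w c) -> \sum_c w c = 1 -> (forall c, `|H c| <= b) -> 0 <= l ->
  \sum_c w c * expR (- l * H c) <=
    expR (- l * (\sum_c w c * H c) + 4 * l ^+ 2 * b ^+ 2).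
Proof.
move=> w0 w1 Hb l0.
have lHb c : `|l * H c| <= l * b by rewrite normrM ger0_norm// ler_wpM2l.
have lh c : - (l * b) <= l * H c <= l * b by have := lHb c; rewrite ler_norml.
have [x2|x2] := leP (l * b) 2^-1.
  apply: (@le_trans _ _ (\sum_c w c * (1 - l * H c + 2 * (l * b) ^+ 2))).
    apply: ler_sum => c _; rewrite ler_wpM2l//.
    have /andP[h1 h2] := lh c.
    rewrite mulNr; apply: le_trans (expR_le_quadratic _) _; first by lra.
    rewrite lerD2l ler_wpM2l// sqrrN -[leLHS]real_normK ?num_real//.
    by apply: lerXn2r; rewrite ?nnegrE//; apply: le_trans (lHb c).
  apply: (@le_trans _ _ (1 + (- l * (\sum_c w c * H c) + 4 * l ^+ 2 * b ^+ 2))); last first.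
    exact: expR_ge1Dx.
  rewrite (eq_bigr (fun c => w c * (1 + 2 * (l * b) ^+ 2) + - l * (w c * H c))); last first.
    by move=> c _; ring.
  rewrite big_split/= -mulr_suml w1 -mulr_sumr mul1r.
  rewrite (_ : 4 * l ^+ 2 * b ^+ 2 = 4 * (l * b) ^+ 2); last by ring.
  have := sqr_ge0 (l * b).
  by set S := \sum_c _; move: ((l * b) ^+ 2) => q; lra.
apply: (@le_trans _ _ (\sum_c w c * expR (l * b))).
  apply: ler_sum => c _; rewrite ler_wpM2l// ler_expR mulNr.
  by have /andP[h1 h2] := lh c; lra.
rewrite -mulr_suml w1 mul1r ler_expR.
have h : l * (\sum_c w c * H c) <= l * b.
  rewrite ler_wpM2l// -[leRHS]mul1r -w1 mulr_suml; apply: ler_sum => c _.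
  by rewrite ler_wpM2l//; have := Hb c; rewrite ler_norml => /andP[].
have -> : 4 * l ^+ 2 * b ^+ 2 = 4 * (l * b) * (l * b) by ring.
have : 2 * (l * b) <= 4 * (l * b) * (l * b) by rewrite ler_wpM2r//; lra.
by rewrite mulNr; lra.
Qed.

Definition colour_weight (C I : finType) (w : C -> R) (c : {ffun I -> C}) : R :=
  \prod_i w (c i).

Lemma sum_colour_weight (C I : finType) (w : C -> R) :
  \sum_c w c = 1 -> \sum_(c : {ffun I -> C}) colour_weight w c = 1.
Proof.
move=> w1; rewrite /colour_weight -(bigA_distr_bigA (fun _ c => w c)).
by rewrite big1.
Qed.

Lemma colour_weight_ge0 (C I : finType) (w : C -> R) (c : {ffun I -> C}) :
  (forall c, 0 <= w c) -> 0 <= colour_weight w c.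
Proof. by move=> w0; apply: prodr_ge0. Qed.

Lemma colour_chernoff (C I : finType) (w : C -> R) (H : I -> C -> R) (b : I -> R)
    (l s : R) :
  (forall c, 0 <= w c) -> \sum_c w c = 1 ->
  (forall i c, `|H i c| <= b i) -> 0 <= l ->
  \sum_(c : {ffun I -> C} | \sum_i H i (c i) <= s) colour_weight w c <=
    expR (l * s - l * (\sum_i \sum_c w c * H i c) + 4 * l ^+ 2 * \sum_i b i ^+ 2).
Proof.
move=> w0 w1 Hb l0.
apply: (@le_trans _ _ (\sum_(c : {ffun I -> C})
   expR (l * s) * \prod_i (w (c i) * expR (- l * H i (c i))))).
  rewrite big_mkcond/=; apply: ler_sum => c _.
  rewrite big_split/= -expR_sum mulrCA -mulr_sumr -expRD.
  have ww := colour_weight_ge0 c w0.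
  case: ifP => [h|_]; last by rewrite mulr_ge0 ?expR_ge0.
  rewrite /colour_weight -[leLHS]mulr1 ler_wpM2l//.
  rewrite -[leLHS]expR0 ler_expR mulNr -mulrBr mulr_ge0//.
  by rewrite subr_ge0.
rewrite -mulr_sumr -(bigA_distr_bigA (fun i c => w c * expR (- l * H i c))).
rewrite -addrA expRD ler_wpM2l ?expR_ge0//.
rewrite -mulNr !mulr_sumr -big_split/= expR_sum.
apply: ler_prod => i _; rewrite sumr_ge0/=; last first.
  by move=> c _; rewrite mulr_ge0 ?expR_ge0.
exact: weighted_expR_le.
Qed.

End WeightedColours.

Section Rounding.
Context {R : realType}.

(* Some choice does at least as well as the random rounding that is unbiased
   in every coordinate. *)
Lemma unbiased_rounding m n (A : 'I_m -> 'I_n -> R) (lo hi t : 'I_n -> R)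
    (c : 'I_n -> bool -> R) :
  (forall j, 0 <= t j <= 1) -> (forall j, `|hi j - lo j| <= 1) ->
  exists b : 'I_n -> bool,
    \sum_i (\sum_j A i j * ((1 - t j) * lo j + t j * hi j -
                if b j then hi j else lo j)) ^+ 2 + \sum_j c j (b j) <=
    \sum_i \sum_j A i j ^+ 2 + \sum_j ((1 - t j) * c j false + t j * c j true).
Proof.
move=> t01 hilo.
pose y j := (1 - t j) * lo j + t j * hi j.
(* Method of conditional expectations: coordinates are fixed one at a time, and [r] carries the
   image error of those already fixed. *)
suff H (s : seq 'I_n) (r : 'I_m -> R) : uniq s -> exists b : 'I_n -> bool,
    \sum_i (r i + \sum_(j <- s) A i j * (y j - if b j then hi j else lo j)) ^+ 2
      + \sum_(j <- s) c j (b j) <=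
    \sum_i r i ^+ 2 + \sum_(j <- s) (\sum_i A i j ^+ 2) +
     \sum_(j <- s) ((1 - t j) * c j false + t j * c j true).
  have [b hb] := H (index_enum 'I_n) (fun=> 0) (index_enum_uniq _).
  exists b; move: hb; rewrite [X in _ <= X + _ + _ -> _]big1; last by move=> i _; rewrite expr0n.
  rewrite add0r [X in _ <= X + _ -> _]exchange_big/=.
  by under eq_bigr do rewrite add0r.
elim: s r => [|j s IH] r /=.
  by move=> _; exists (fun=> true); rewrite !big_nil !addr0; under eq_bigr do rewrite big_nil addr0.
move=> /andP[js us].
pose r' (v : R) i := r i + A i j * (y j - v).
pose f (e : bool) := \sum_i r' (if e then hi j else lo j) i ^+ 2 + c j e.
have hf : exists e, f e <= \sum_i r i ^+ 2 + \sum_i A i j ^+ 2 +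
    ((1 - t j) * c j false + t j * c j true).
  (* As [y j] is the mean of the two roundings, the terms linear in the residual cancel and only the
     variance is left. *)
  have E : (1 - t j) * f false + t j * f true = \sum_i r i ^+ 2 +
      (\sum_i A i j ^+ 2) * (t j * (1 - t j) * (hi j - lo j) ^+ 2) +
      ((1 - t j) * c j false + t j * c j true).
    rewrite /f !mulrDr addrACA; congr (_ + _).
    rewrite !mulr_sumr mulr_suml -!big_split/=; apply: eq_bigr => i _.
    by rewrite /r' /y; ring.
  have [t0 t1] := andP (t01 j).
  have le1 : t j * (1 - t j) * (hi j - lo j) ^+ 2 <= 1.
    apply: mulr_ile1; rewrite ?sqr_ge0//.
    - by rewrite mulr_ge0// subr_ge0.
    - by apply: mulr_ile1 => //; rewrite ?subr_ge0// lerBlDr lerDl.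
    - rewrite -real_normK ?num_real//; apply: exprn_ile1 => //.
  have hA : (\sum_i A i j ^+ 2) * (t j * (1 - t j) * (hi j - lo j) ^+ 2) <=
      \sum_i A i j ^+ 2.
    by rewrite ler_piMr// sumr_ge0// => i _; exact: sqr_ge0.
  set M := (X in exists e, _ <= X).
  have {}E : (1 - t j) * f false + t j * f true <= M by rewrite E /M; lra.
  (* If both choices exceeded the bound, so would their weighted mean. *)
  apply: contrapT => /forallNP h.
  have hN e : M < f e by rewrite ltNge; apply/negP; exact: h.
  have h0 : (1 - t j) * (f false - M) + t j * (f true - M) <= 0.
    by rewrite -subr_ge0 -[X in _ <= X]opprB; lra.
  have g0 : 0 < f false - M by rewrite subr_gt0.
  have g1 : 0 < f true - M by rewrite subr_gt0.
  have [tz|tz] := eqVneq (t j) 0; first by move: h0; rewrite tz; lra.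
  have tp : 0 < t j by rewrite lt_neqAle eq_sym tz.
  have := mulr_gt0 tp g1.
  have : 0 <= (1 - t j) * (f false - M) by rewrite mulr_ge0 ?subr_ge0// ltW.
  by lra.
have [e he] := hf.
have [b hb] := IH (r' (if e then hi j else lo j)) us.
exists (fun k => if k == j then e else b k).
rewrite !big_cons eqxx.
have ES : \sum_(k <- s) c k (if k == j then e else b k) = \sum_(k <- s) c k (b k).
  apply: eq_big_seq => k ks; case: eqP => // kj.
  by move: js; rewrite -kj ks.
rewrite ES.
have EA : \sum_i (r i + \sum_(k <- j :: s) A i k * (y k -
        if (if k == j then e else b k) then hi k else lo k)) ^+ 2 =
   \sum_i (r' (if e then hi j else lo j) i +
     \sum_(k <- s) A i k * (y k - if b k then hi k else lo k)) ^+ 2.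
  apply: eq_bigr => i _; congr (_ ^+ 2); rewrite big_cons eqxx /r' addrA.
  congr (_ + _); apply: eq_big_seq => k ks; case: eqP => // kj.
  by move: js; rewrite -kj ks.
rewrite EA; move: he hb; rewrite /f.
by lra.
Qed.

End Rounding.

(** * Matrices without sparse almost-kernel lattice points *)

Lemma prob_exists_le d (T : measurableType d) (R : realType)
    (P : probability T R) (I : finType) (Q : pred I) (A : I -> set T) (p : R) :
  (forall i, measurable (A i)) -> (forall i, Q i -> (P (A i) <= p%:E)%E) ->
  (P [set w | exists2 i, Q i & A i w] <= (p * \sum_(i | Q i) 1)%:E)%E.
Proof.
move=> mA PA.
have -> : [set w | exists2 i, Q i & A i w] = \big[setU/set0]_(i | Q i) A i.
  apply/seteqP; split=> w /=; rewrite -bigcup_seq_cond/=.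
    by move=> [i Qi Aw]; exists i => //=; rewrite mem_index_enum.
  by move=> [i /= /andP[_ Qi] Aw]; exists i.
suff H (r : seq I) : measurable (\big[setU/set0]_(i <- r | Q i) A i) /\
    (P (\big[setU/set0]_(i <- r | Q i) A i) <= (p * \sum_(i <- r | Q i) 1)%:E)%E.
  by case: (H (index_enum I)).
elim: r => [|i r [mr Pr]]; first by rewrite !big_nil measure0 mulr0.
rewrite !big_cons; case: ifP => // Qi; split; first exact: measurableU.
rewrite mulrDr mulr1 EFinD; apply: le_trans (measureU2 _ _ _) _ => //.
by apply: leeD => //; exact: PA.
Qed.

Lemma measurable_set_le d (T : measurableType d) (R : realType) (f g : T -> R) :
  measurable_fun setT f -> measurable_fun setT g -> measurable [set w | f w <= g w].
Proof.
by move=> mf mg; rewrite -[X in measurable X]setTI; exact: measurable_fun_le.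
Qed.

Lemma measurable_set_lt d (T : measurableType d) (R : realType) (f g : T -> R) :
  measurable_fun setT f -> measurable_fun setT g -> measurable [set w | f w < g w].
Proof.
move=> mf mg; rewrite (_ : [set w | f w < g w] = ~` [set w | g w <= f w]).
  by apply: measurableC; exact: measurable_set_le.
by apply/seteqP; split=> w /=; rewrite ltNge => /negP.
Qed.

Section GoodMatrices.
Context {R : realType}.

(* A signed integer of absolute value at most [N]; 0 is represented twice. *)
Definition lattice_val N (x : 'I_N.+1 * bool) : R :=
  (if x.2 then 1 else -1) * (x.1 : nat)%:R.

Definition lattice_radius (n : nat) (e : R) : nat := (Num.truncn (n%:R / e)).+1.

(** The l_1 budget is that of a rounded z/e with z of squared norm n: at most n/e by Cauchy-Schwarz,
    plus at most 1 per coordinate for rounding away from 0. *)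
Definition sparse_lattice n N (e : R) (s : nat) (v : {ffun 'I_n -> 'I_N.+1 * bool}) :=
  (\sum_i ((v i).1 : nat)%:R <= 2 * n%:R / e) &&
  (#|[set i | ((v i).1 : nat) != 0%N]%SET| <= s)%N.

Definition image_sqr m n (A : 'I_m * 'I_n -> R) (z : 'I_n -> R) : R :=
  \sum_i (\sum_j A (i, j) * z j) ^+ 2.

(** The bound 8 m n is the error that rounding can cause: 4 m n from the Frobenius norm and 4 m n
    from a penalty on small coordinates rounded away from 0. The length condition asks for a quarter
    of |z/e|^2 = n/e^2. *)
Definition good_matrix m n (e : R) (s : nat) (A : 'I_m * 'I_n -> R) : Prop :=
  \sum_k A k ^+ 2 <= 4 * (m%:R * n%:R) /\
  forall v : {ffun 'I_n -> 'I_(lattice_radius n e).+1 * bool},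
    sparse_lattice e s v && (n%:R / (4 * e ^+ 2) <= \sum_j lattice_val (v j) ^+ 2) ->
    8 * (m%:R * n%:R) < image_sqr A (fun j => lattice_val (v j)).

Lemma measurable_image_sqr m n (z : 'I_n -> R) :
  measurable_fun [set: coords R ('I_m * 'I_n)%type] (fun A => image_sqr A z).
Proof.
rewrite (_ : (fun A => _) = (fun x : coords R ('I_m * 'I_n)%type =>
   \sum_i 1 * (\sum_k z k * x (i, k)) ^+ 2)).
  exact: (measurable_quad (fun=> 1) (fun ik => z ik.2)).
apply/funext => x; apply: eq_bigr => i _; rewrite mul1r; congr (_ ^+ 2).
by apply: eq_bigr => j _; rewrite mulrC.
Qed.

Lemma measurable_sum_sqr (I : finType) :
  measurable_fun [set: coords R I] (fun x => \sum_k x k ^+ 2).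
Proof.
apply: measurable_sum => k.
apply: (@measurable_funX _ (coords R I) R setT (fun x => x k)).
exact: measurable_coord.
Qed.

Lemma measurable_good_matrix m n (e : R) s :
  measurable ([set A | good_matrix e s A] : set (coords R ('I_m * 'I_n)%type)).
Proof.
rewrite (_ : mkset _ = [set A | \sum_k A k ^+ 2 <= 4 * (m%:R * n%:R)] `&`
   \bigcap_(v in [set v : {ffun 'I_n -> 'I_(lattice_radius n e).+1 * bool} |
      sparse_lattice e s v && (n%:R / (4 * e ^+ 2) <= \sum_j lattice_val (v j) ^+ 2)])
     [set A | 8 * (m%:R * n%:R) < image_sqr A (fun j => lattice_val (v j))]).
  apply: measurableI.
    apply: measurable_set_le => //.
    exact: measurable_sum_sqr.
  apply: fin_bigcap_measurable => // v _.
  apply: measurable_set_lt => //.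
  exact: measurable_image_sqr.
by apply/seteqP; split.
Qed.

Lemma measurable_not_good_matrix m n (e : R) s d (T : measurableType d)
    (P : probability T R) (G : 'I_m * 'I_n -> T -> R) :
  gaussian_family P G -> measurable [set w | ~ good_matrix e s (G ^~ w)].
Proof.
move=> gG; rewrite (_ : mkset _ =
    ~` ((fun w => (G ^~ w) : coords R ('I_m * 'I_n)%type) @^-1`
      [set A | good_matrix e s A])); last by [].
apply: measurableC; rewrite -[_ @^-1` _]setTI.
by apply: (gaussian_family_measurable gG) => //; exact: measurable_good_matrix.
Qed.

(** Chernoff with exponent 1/4 gives exp(- m n) sqrt 2^(m n), and sqrt 2 <= exp(1/2). *)
Lemma frobenius_tail m n d (T : measurableType d) (P : probability T R)
    (G : 'I_m * 'I_n -> T -> R) :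
  gaussian_family P G ->
  (P [set w | (4 * (m%:R * n%:R) < \sum_k G k w ^+ 2)%R] <=
   (expR (- (m%:R * n%:R / 2)))%:E)%E.
Proof.
move=> gG.
have mG := gaussian_family_measurable gG.
have mS : measurable_fun setT (fun w => \sum_k G k w ^+ 2).
  exact: (@measurableT_comp _ _ _ _ (coords R _) _ _ _ _
           (@measurable_sum_sqr _) mG).
have mh : measurable_fun setT (fun w => - \sum_(k in [set: 'I_m * 'I_n]%SET) G k w ^+ 2 / 4).
  apply: measurableT_comp => //.
  rewrite (_ : (fun w => _) = (fun w => (\sum_k G k w ^+ 2) * 4^-1)).
    exact: (measurable_funM mS (measurable_cst _)).
  apply/funext => w; rewrite mulr_suml; apply: eq_bigl => k; exact: finset.in_setT.
have C := chernoff P (- (m%:R * n%:R)) mh.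
have : (P [set w | (4 * (m%:R * n%:R) < \sum_k G k w ^+ 2)%R] <=
   P [set w | (- \sum_(k in [set: 'I_m * 'I_n]%SET) G k w ^+ 2 / 4 <= - (m%:R * n%:R))%R])%E.
  apply: le_measure; rewrite ?inE.
  - by apply: measurable_set_lt.
  - by apply: measurable_set_le.
  move=> w /= h; rewrite lerN2 -mulr_suml.
  by rewrite (eq_bigl _ _ (@finset.in_setT _)); lra.
move=> /le_trans; apply; apply: le_trans C _.
under eq_integral do rewrite opprK.
rewrite gaussian_family_expR_sum_sqr// cardsT card_prod !card_ord -EFinM lee_fin.
set k := (m * n)%N.
have -> : m%:R * n%:R = k%:R :> R by rewrite natrM.
have s2 : Num.sqrt 2 <= expR (2^-1) :> R.
  rewrite -(ler_pXn2r (n := 2))// ?nnegrE ?sqrtr_ge0 ?expR_ge0//.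
  rewrite sqr_sqrtr// -expRM_natl mulfV//.
  by apply: le_trans (expR_ge1Dx _); lra.
apply: (@le_trans _ _ (expR (- k%:R) * expR (2^-1) ^+ k)).
  by rewrite ler_wpM2l ?expR_ge0// lerXn2r ?nnegrE ?sqrtr_ge0 ?expR_ge0.
by rewrite -expRM_natl -expRD ler_expR; lra.
Qed.

(** Chernoff with parameter 1/n gives exp(8 m) (1 + 2 |z|^2/n)^(-m/2), and the root of 1 + 2 |z|^2/n
    is at least 1/(2 e). The exponent 9 is 8 plus 1, the latter absorbing the factor 2. *)
Lemma small_image_prob m n (e : R) (z : 'I_n -> R) d (T : measurableType d)
    (P : probability T R) (G : 'I_m * 'I_n -> T -> R) :
  gaussian_family P G -> (0 < n)%N -> 0 < e ->
  n%:R / (4 * e ^+ 2) <= \sum_j z j ^+ 2 ->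
  (P [set w | (image_sqr (G ^~ w) z <= 8 * (m%:R * n%:R))%R] <=
    ((expR 9 * e) ^+ m)%:E)%E.
Proof.
move=> gG n0 e0 hz.
have n0' : 0 < n%:R :> R by rewrite ltr0n.
pose l : 'I_m -> R := fun=> n%:R^-1; pose a (ik : 'I_m * 'I_n) := z ik.2.
have mG := gaussian_family_measurable gG.
have mh : measurable_fun setT (fun w => \sum_i l i * (\sum_k a (i, k) * G (i, k) w) ^+ 2).
  exact: (@measurableT_comp _ _ _ _ (coords R _) _ _ _ _
           (measurable_quad l a) mG).
have C := chernoff P (8 * m%:R) mh.
rewrite gaussian_family_expR_quad// in C; last by move=> i; rewrite /l invr_ge0 ltW.
have E w : \sum_i l i * (\sum_k a (i, k) * G (i, k) w) ^+ 2 =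
    image_sqr (G ^~ w) z / n%:R.
  rewrite -mulr_sumr mulrC; congr (_ / _); apply: eq_bigr => i _.
  by congr (_ ^+ 2); apply: eq_bigr => j _; rewrite mulrC.
have -> : [set w | (image_sqr (G ^~ w) z <= 8 * (m%:R * n%:R))%R] =
  [set w | (\sum_i l i * (\sum_k a (i, k) * G (i, k) w) ^+ 2 <= 8 * m%:R)%R].
  by apply/seteqP; split=> w /=; rewrite E ler_pdivrMr// mulrA.
apply: le_trans C _; rewrite -EFinM lee_fin.
set S := \sum_j z j ^+ 2 in hz.
rewrite (eq_bigr (fun=> (Num.sqrt (1 + 2 * n%:R^-1 * S))^-1))// prodr_const card_ord.
rewrite [8 * _]mulrC expRM_natl -exprMn.
apply: lerXn2r; rewrite ?nnegrE ?mulr_ge0 ?invr_ge0 ?expR_ge0 ?sqrtr_ge0 ?(ltW e0)//.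
rewrite [X in expR X * e](_ : 9 = 8 + 1); last by lra.
rewrite [expR (8 + 1)]expRD -[leRHS]mulrA ler_wpM2l ?expR_ge0//.
have h1 : (2 * e)^-1 <= Num.sqrt (1 + 2 * n%:R^-1 * S).
  have e2 : 0 <= (2 * e)^-1 by rewrite invr_ge0 mulr_ge0 ?(ltW e0).
  rewrite -[leLHS]ger0_norm// -sqrtr_sqr ler_sqrt; last first.
    rewrite addr_ge0// mulr_ge0 ?mulr_ge0 ?invr_ge0 ?(ltW n0')//.
    by apply: sumr_ge0 => j _; exact: sqr_ge0.
  have : (4 * e ^+ 2)^-1 <= n%:R^-1 * S.
    by rewrite -(ler_pM2l n0') [leRHS]mulrA divff ?gt_eqF// mul1r.
  rewrite exprVn exprMn -natrX; have : 0 <= (4 * e ^+ 2)^-1.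
    by rewrite invr_ge0 mulr_ge0 ?sqr_ge0.
  by set q := n%:R^-1 * S; rewrite -mulrA -/q; set x := (4 * _)^-1; lra.
rewrite -[leRHS]invrK lef_pV2 ?posrE ?invr_gt0 ?mulr_gt0 ?expR_gt0//; last first.
  by apply: lt_le_trans h1; rewrite invr_gt0 mulr_gt0.
apply: le_trans h1; rewrite lef_pV2 ?posrE ?mulr_gt0 ?expR_gt0//.
rewrite ler_wpM2r ?(ltW e0)//.
by apply: le_trans (expR_ge1Dx _); lra.
Qed.

(* The scale is chosen so that [(expR 9 * e) ^+ (m - s) <= expR (- 14 n)], which
   beats the count of sparse lattice points. *)
Lemma good_matrix_prob m n (b : R) (s : nat) d (T : measurableType d)
    (P : probability T R) (G : 'I_m * 'I_n -> T -> R) :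
  gaussian_family P G -> (0 < n)%N -> 0 < b -> b <= 1 -> (s <= n)%N ->
  s%:R + b * n%:R <= m%:R ->
  (P [set w | ~ good_matrix (expR (- (9 + 14 / b))) s (G ^~ w)] <=
   (expR (- (n%:R / 2)) + expR (- n%:R))%:E)%E.
Proof.
move=> gG n0 b0 b1 sn smn.
set e := expR _; have e0 : 0 < e by exact: expR_gt0.
have n0' : 0 < n%:R :> R by rewrite ltr0n.
have mG := gaussian_family_measurable gG.
have s0 : 0 <= s%:R :> R by [].
have m0 : (0 < m)%N by rewrite -(ltr0n R); have := mulr_gt0 b0 n0'; lra.
have sm : (s <= m)%N by rewrite -(ler_nat R); have := mulr_gt0 b0 n0'; lra.
pose Q (v : {ffun 'I_n -> 'I_(lattice_radius n e).+1 * bool}) :=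
  sparse_lattice e s v && (n%:R / (4 * e ^+ 2) <= \sum_j lattice_val (v j) ^+ 2).
pose A (v : {ffun 'I_n -> 'I_(lattice_radius n e).+1 * bool}) :=
  [set w | (image_sqr (G ^~ w) (fun j => lattice_val (v j)) <= 8 * (m%:R * n%:R))%R].
pose B := [set w | (4 * (m%:R * n%:R) < \sum_k G k w ^+ 2)%R].
have mA v : measurable (A v).
  apply: measurable_set_le => //.
  exact: (@measurableT_comp _ _ _ _ (coords R _) _ _ _ _
           (measurable_image_sqr _) mG).
have mB : measurable B.
  apply: measurable_set_lt => //.
  exact: (@measurableT_comp _ _ _ _ (coords R _) _ _ _ _
           (@measurable_sum_sqr _) mG).
have mU : measurable [set w | exists2 v, Q v & A v w].
  rewrite (_ : mkset _ = \bigcup_(v in [set v | Q v]) A v).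
    by apply: fin_bigcup_measurable.
  by apply/seteqP; split.
have sub : [set w | ~ good_matrix e s (G ^~ w)] `<=` B `|` [set w | exists2 v, Q v & A v w].
  move=> w /= ng; have [hB|hB] := ltP (4 * (m%:R * n%:R)) (\sum_k G k w ^+ 2).
    by left.
  right; apply: contrapT => h; apply: ng; split => // v Qv.
  by rewrite ltNge; apply/negP => hA; apply: h; exists v.
have mN : measurable [set w | ~ good_matrix e s (G ^~ w)].
  exact: measurable_not_good_matrix gG.
apply: (@le_trans _ _ (P (B `|` [set w | exists2 v, Q v & A v w]))).
  by apply: le_measure; rewrite ?inE//; exact: measurableU.
apply: le_trans (measureU2 _ mB mU) _; rewrite EFinD; apply: leeD.
  apply: le_trans (frobenius_tail gG) _; rewrite lee_fin ler_expR lerN2.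
  by rewrite ler_pM2r// ler_peMl// ler1n.
apply: le_trans (prob_exists_le (Q := Q) mA (p := (expR 9 * e) ^+ m) _) _.
  by move=> v /andP[_ hv]; exact: small_image_prob.
rewrite lee_fin.
have e1 : e <= 1.
  by rewrite -[leRHS]expR0 ler_expR oppr_le0 addr_ge0// divr_ge0// ltW.
have count : \sum_(v | Q v) 1 <= expR (e * (2 * n%:R / e)) * 4 ^+ n * e^-1 ^+ s.
  apply: le_trans (lattice_count n (lattice_radius n e) s (2 * n%:R / e) e0 _ (lexx e^-1)).
    rewrite [leRHS]big_mkcond/= [leLHS]big_mkcond/=; apply: ler_sum => v _.
    rewrite /Q -/(sparse_lattice e s v); case: (sparse_lattice _ _ _) => //=.
    by case: ifP.
  by rewrite invf_ge1.
have E : e * (2 * n%:R / e) = 2 * n%:R by rewrite mulrC divfK// gt_eqF.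
rewrite {}E in count.
have four : 4 ^+ n <= expR 2 ^+ n :> R := expr4_le_expR n.
apply: (@le_trans _ _ ((expR 9 * e) ^+ m *
   (expR (2 * n%:R) * expR 2 ^+ n * e^-1 ^+ s))).
  rewrite ler_wpM2l ?exprn_ge0 ?mulr_ge0 ?expR_ge0//.
  apply: le_trans count _; rewrite ler_wpM2r ?exprn_ge0 ?invr_ge0 ?expR_ge0//.
  by rewrite ler_wpM2l ?expR_ge0.
rewrite -expRN -expRD -!expRM_natl -!expRD ler_expR opprK.
have -> : m%:R * (9 + - (9 + 14 / b)) = - (m%:R * 14 / b) by ring.
rewrite -subr_ge0.
(* The 14 pays for 2n from the l_1 budget, 2n from 4^n, at most 9n from the scale at the s nonzero
   entries, and leaves the rate n. *)
have -> : - n%:R - (- (m%:R * 14 / b) + (2 * n%:R + n%:R * 2 + s%:R * (9 + 14 / b))) =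
   (m%:R - s%:R) / b * 14 - 5 * n%:R - 9 * s%:R :> R by ring.
have : n%:R <= (m%:R - s%:R) / b by rewrite ler_pdivlMr// mulrC; lra.
have : s%:R <= n%:R :> R by rewrite ler_nat.
by lra.
Qed.

End GoodMatrices.

(** * Kernel vectors of good matrices are spread *)

Section Spread.
Context {R : realType}.

Definition in_kernel m n (A : 'I_m * 'I_n -> R) (z : 'I_n -> R) : Prop :=
  forall i, \sum_j A (i, j) * z j = 0.

Lemma norm_sub_le1 (u v : R) : 0 <= u - v <= 1 ->
  `|u - v| <= 1 /\ `|u - (v + 1)| <= 1.
Proof. by move=> /andP[h1 h2]; rewrite !ler_norml; split; lra. Qed.

(* The rounding of [z / e] is a sparse lattice point that [A] maps close to 0. *)
Lemma good_matrix_kernel m n (A : 'I_m * 'I_n -> R) (e th : R) (s : nat) (z : 'I_n -> R) :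
  (0 < m)%N -> (0 < n)%N -> 0 < e -> e <= 2^-1 -> 0 < th -> th < 1 ->
  good_matrix e s A -> in_kernel A z -> \sum_j z j ^+ 2 = n%:R ->
  s%:R < (n - #|[set j | `|z j| <= th * e]%SET|)%:R + 2 * th * n%:R /\ (s < n)%N.
Proof.
move=> m0 n0 e0 e2 th0 th1 [frob hA] zker zn.
have n0' : 0 < n%:R :> R by rewrite ltr0n.
have m0' : 0 < m%:R :> R by rewrite ltr0n.
set J := [set j | _]%SET.
pose y j := z j / e.
pose sg j : R := if 0 <= y j then 1 else -1.
pose k j := Num.truncn `|y j|.
pose t j := `|y j| - (k j)%:R.
have sgy j : sg j * `|y j| = y j.
  rewrite /sg; case: (lerP 0 (y j)) => h; first by rewrite mul1r ger0_norm.
  by rewrite ltr0_norm// mulN1r opprK.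
have sg1 j : `|sg j| = 1 by rewrite /sg; case: ifP; rewrite ?normrN normr1.
have kt j : (k j)%:R <= `|y j| < (k j).+1%:R by rewrite /k truncn_itv.
have t01 j : 0 <= t j <= 1.
  have /andP[h1 h2] := kt j; rewrite /t subr_ge0 h1/=.
  by move: h2; rewrite -addn1 natrD; lra.
pose lo j := sg j * (k j)%:R; pose hi j := sg j * (k j).+1%:R.
have hilo j : `|hi j - lo j| <= 1.
  by rewrite /hi /lo -mulrBr normrM sg1 mul1r -addn1 natrD addrAC subrr add0r normr1.
have yE j : (1 - t j) * lo j + t j * hi j = y j.
  by rewrite -[RHS]sgy /lo /hi -addn1 natrD /t; ring.
(* A coordinate in [J] is rounded away from 0 with probability at most [th]. With penalty [w] the
   expected cost is at most 4 m n, the same as the Frobenius budget, so at most 8 m n / w = 2 th n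
   coordinates of [J] become nonzero. *)
pose w : R := 4 * m%:R / th.
pose c j (b : bool) : R := if (j \in J) && b then w else 0.
have w0 : 0 < w by rewrite /w divr_gt0 ?mulr_gt0.
have [b hb] := unbiased_rounding (fun i j => A (i, j)) c t01 hilo.
have JP j : j \in J -> `|y j| <= th /\ k j = 0%N.
  rewrite inE => h; have hy : `|y j| <= th.
    by rewrite /y normf_div (gtr0_norm e0) ler_pdivrMr.
  split => //; have /andP[h1 _] := kt j.
  have := le_lt_trans h1 (le_lt_trans hy th1).
  by rewrite (ltr_nat R _ 1) ltnS leqn0 => /eqP.
have costE : \sum_j ((1 - t j) * c j false + t j * c j true) <= 4 * (m%:R * n%:R).
  apply: (@le_trans _ _ (\sum_(j : 'I_n) th * w)).
    apply: ler_sum => j _; rewrite /c andbF mulr0 add0r andbT.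
    have [jJ|jJ] := boolP (j \in J); last by rewrite mulr0 mulr_ge0 ?ltW.
    have [h1 h2] := JP j jJ; rewrite ler_wpM2r ?(ltW w0)//.
    by rewrite /t h2 subr0.
  rewrite sumr_const card_ord -[leLHS]mulr_natr /w.
  by rewrite [th * _]mulrC divfK ?gt_eqF// -mulrA.
have frobE : \sum_i \sum_j A (i, j) ^+ 2 <= 4 * (m%:R * n%:R).
  by rewrite pair_big/= (eq_bigr (fun k => A k ^+ 2))// => -[].
have tot : \sum_i (\sum_j A (i, j) * ((1 - t j) * lo j + t j * hi j -
      (if b j then hi j else lo j))) ^+ 2 + \sum_j c j (b j) <= 8 * (m%:R * n%:R).
  by apply: le_trans hb _; lra.
have cost0 : 0 <= \sum_j c j (b j).
  by apply: sumr_ge0 => j _; rewrite /c; case: ifP => // _; exact: ltW.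
have im0 : 0 <= \sum_i (\sum_j A (i, j) * ((1 - t j) * lo j + t j * hi j -
      (if b j then hi j else lo j))) ^+ 2.
  by apply: sumr_ge0 => i _; exact: sqr_ge0.
have cnt : (#|[set j in J | b j]%SET|)%:R <= 2 * th * n%:R.
  have : \sum_j c j (b j) <= 8 * (m%:R * n%:R) by lra.
  rewrite /c -big_mkcond/= sumr_const.
  have -> : #|[pred j | (j \in J) && b j]| = #|[set j in J | b j]%SET|.
    by apply: eq_card => j; rewrite !inE.
  rewrite -[X in X <= _ -> _]mulr_natr -ler_pdivlMl// => /le_trans; apply.
  rewrite /w le_eqVlt; apply/orP; left; apply/eqP; field.
  by rewrite !gt_eqF.
have yb j : `|y j| <= n%:R / e.
  have h : `|y j| ^+ 2 <= (n%:R / e) ^+ 2.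
    rewrite /y normf_div (gtr0_norm e0) !expr_div_n ler_wpM2r ?invr_ge0 ?sqr_ge0//.
    rewrite real_normK ?num_real//.
    apply: (@le_trans _ _ n%:R).
      by rewrite -zn (bigD1 j)//= lerDl sumr_ge0// => i _; exact: sqr_ge0.
    by rewrite expr2 ler_peMl// ler1n.
  rewrite -(ler_pXn2r (n := 2))// nnegrE ?divr_ge0// ltW//.
have kN j (b' : bool) : ((k j + b')%N < (lattice_radius n e).+1)%N.
  rewrite /lattice_radius ltnS -[X in (_ <= X)%N]addn1 leq_add ?leq_b1//.
  by apply: le_truncn.
pose v : {ffun 'I_n -> 'I_(lattice_radius n e).+1 * bool} :=
  [ffun j => (Ordinal (kN j (b j)), 0 <= y j)].
have vE j : lattice_val (v j) = if b j then hi j else lo j.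
  rewrite /lattice_val ffunE/= -/(sg j) /hi /lo.
  by case: (b j); rewrite ?addn1 ?addn0.
have Sy : \sum_j y j ^+ 2 = n%:R / e ^+ 2.
  by rewrite -zn mulr_suml; apply: eq_bigr => j _; rewrite expr_div_n.
have small : image_sqr A (fun j => lattice_val (v j)) <= 8 * (m%:R * n%:R).
  apply: (@le_trans _ _ (\sum_i (\sum_j A (i, j) * ((1 - t j) * lo j + t j * hi j -
      (if b j then hi j else lo j))) ^+ 2)); last by lra.
  (* Since A y = 0, the image of the lattice point is minus the image of the rounding error. *)
  rewrite le_eqVlt; apply/orP; left; apply/eqP; apply: eq_bigr => i _.
  have ky : \sum_j A (i, j) * y j = 0.
    rewrite (eq_bigr (fun j => A (i, j) * z j / e)); last by move=> j _; rewrite mulrA.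
    by rewrite -mulr_suml zker mul0r.
  rewrite -[RHS]sqrrN; congr (_ ^+ 2); apply/eqP.
  rewrite -addr_eq0 -big_split/= -[X in _ == X]ky; apply/eqP.
  apply: eq_bigr => j _; rewrite yE vE.
  by move: (if b j then _ else _) => x; ring.
have big : n%:R / (4 * e ^+ 2) <= \sum_j lattice_val (v j) ^+ 2.
  (* From |y - x| <= 1 one gets x^2 >= y^2/2 - 1; the loss n is absorbed because e <= 1/2 makes
     n/e^2 at least 4n. *)
  apply: (@le_trans _ _ (\sum_j (y j ^+ 2 / 2 - 1))).
    rewrite big_split/= -mulr_suml Sy sumr_const card_ord.
    rewrite (_ : (-1) *+ n = - n%:R :> R); last by rewrite mulNrn.
    have E4 : n%:R / (4 * e ^+ 2) = n%:R / e ^+ 2 / 4 by rewrite invfM mulrA mulrAC.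
    rewrite E4.
    have h : 4 <= (e ^+ 2)^-1.
      rewrite -[leLHS]invrK lef_pV2 ?posrE ?invr_gt0 ?exprn_gt0//.
      apply: (@le_trans _ _ (2^-1 ^+ 2)); last by rewrite exprVn -natrX.
      by apply: lerXn2r; rewrite ?nnegrE ?(ltW e0)//.
    have := ler_wpM2l (ltW n0') h.
    by set q := n%:R / e ^+ 2; lra.
  apply: ler_sum => j _; rewrite vE.
  set x := (if b j then _ else _).
  have hx : `|y j - x| <= 1.
    have [h1 h2] := norm_sub_le1 (t01 j).
    rewrite /x; case: (b j); rewrite -[X in X - _](sgy j) -mulrBr normrM sg1 mul1r//.
    by rewrite -addn1 natrD.
  have : (y j - x) ^+ 2 <= 1.
    by rewrite -real_normK ?num_real//; apply: exprn_ile1.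
  have := sqr_ge0 (y j - 2 * x); rewrite !sqrrB.
  rewrite (_ : (2 * x) ^+ 2 = 4 * x ^+ 2); last by ring.
  rewrite (_ : y j * (2 * x) *+ 2 = 4 * (y j * x)); last by ring.
  by rewrite -[y j * x *+ 2]mulr_natr; lra.
have kS : \sum_j ((v j).1 : nat)%:R <= 2 * n%:R / e.
  (* The arithmetic-geometric mean inequality bounds |y_j|; the 1 pays for rounding away from 0. *)
  apply: (@le_trans _ _ (\sum_j ((e * y j ^+ 2 + e^-1) / 2 + 1))).
    apply: ler_sum => j _; rewrite ffunE/= natrD; apply: lerD.
      have [h1 _] := andP (kt j); apply: le_trans h1 _.
      have : 0 <= (e * `|y j| - 1) ^+ 2 / e by rewrite divr_ge0 ?sqr_ge0// ltW.
      have -> : (e * `|y j| - 1) ^+ 2 / e = e * `|y j| ^+ 2 + e^-1 - 2 * `|y j|.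
        by field; rewrite gt_eqF.
      by rewrite real_normK ?num_real//; lra.
    by case: (b j).
  rewrite big_split/= -mulr_suml big_split/= -mulr_sumr Sy !sumr_const card_ord.
  rewrite -[e^-1 *+ n]mulr_natl.
  have -> : e * (n%:R / e ^+ 2) = n%:R / e by field; rewrite gt_eqF.
  have : n%:R <= n%:R / e :> R.
    by rewrite ler_pdivlMr// ler_piMr//; lra.
  by move=> h; rewrite -[leRHS]mulrA; move: h; set q := n%:R / e; lra.
have supp : (#|[set j | ((v j).1 : nat) != 0%N]%SET| <= n - #|J| + #|[set j in J | b j]%SET|)%N.
  have -> : (n - #|J|)%N = #|~: J| by rewrite [#|~: J|]cardsCs finset.setCK card_ord.
  apply: leq_trans (leq_card_setU _ _).
  apply: subset_leq_card; apply/fintype.subsetP => j; rewrite !inE ffunE/=.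
  have [|jJ] := boolP (`|z j| <= th * e); last by [].
  move=> h; have jJ : j \in J by rewrite inE.
  by rewrite (JP j jJ).2 add0n; case: (b j).
have ns : (s < #|[set j | ((v j).1 : nat) != 0%N]%SET|)%N.
  rewrite ltnNge; apply/negP => hs.
  have /hA : sparse_lattice e s v && (n%:R / (4 * e ^+ 2) <= \sum_j lattice_val (v j) ^+ 2).
    by rewrite /sparse_lattice kS hs big.
  by rewrite ltNge small.
split.
  apply: (@lt_le_trans _ _ (#|[set j | ((v j).1 : nat) != 0%N]%SET|)%:R).
    by rewrite ltr_nat.
  apply: (@le_trans _ _ (n - #|J| + #|[set j in J | b j]%SET|)%:R).
    by rewrite ler_nat.
  by rewrite natrD lerD2l.
apply: leq_trans ns _; apply: leq_trans (max_card _) _.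
by rewrite card_ord.
Qed.

End Spread.

(** * Nets of the kernel *)

Section KernelNet.
Context {R : realType}.
Variables (m n : nat) (A : 'I_m * 'I_n -> R).

Definition dotp (u v : 'I_n -> R) : R := \sum_j u j * v j.

Lemma dotp_ge0 u : 0 <= dotp u u.
Proof. by apply: sumr_ge0 => j _; rewrite -expr2 sqr_ge0. Qed.

Lemma dotp_eq0 u : dotp u u = 0 -> forall j, u j = 0.
Proof.
move=> /eqP; rewrite psumr_eq0 => [/allP h j|j _]; last by rewrite -expr2 sqr_ge0.
have := h j (mem_index_enum j); rewrite -expr2/= sqrf_eq0.
by move/eqP.
Qed.

Definition orthonormal_in_kernel k (e : 'I_k -> 'I_n -> R) : Prop :=
  (forall a, in_kernel A (e a)) /\ forall a b, dotp (e a) (e b) = (a == b)%:R.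

Lemma in_kernel_comb k (e : 'I_k -> 'I_n -> R) (u : 'I_k -> R) :
  (forall a, in_kernel A (e a)) -> in_kernel A (fun j => \sum_a u a * e a j).
Proof.
move=> ke i; rewrite (eq_bigr (fun j => \sum_a u a * (A (i, j) * e a j))).
  by rewrite exchange_big/= big1// => a _; rewrite -mulr_sumr ke mulr0.
by move=> j _; rewrite mulr_sumr; apply: eq_bigr => a _; ring.
Qed.

Lemma in_kernelZ (c : R) z : in_kernel A z -> in_kernel A (fun j => c * z j).
Proof.
move=> kz i; rewrite (eq_bigr (fun j => c * (A (i, j) * z j))).
  by rewrite -mulr_sumr kz mulr0.
by move=> j _; ring.
Qed.

Lemma dotp_comb k (e : 'I_k -> 'I_n -> R) (u : 'I_k -> R) (b : 'I_k) :
  orthonormal_in_kernel e -> dotp (fun j => \sum_a u a * e a j) (e b) = u b.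
Proof.
move=> [_ oe]; rewrite /dotp (eq_bigr (fun j => \sum_a u a * (e a j * e b j))).
  rewrite exchange_big/= (bigD1 b)//= -mulr_sumr -/(dotp _ _) oe eqxx mulr1.
  rewrite big1 ?addr0// => a /negbTE ab.
  by rewrite -mulr_sumr -/(dotp _ _) oe ab mulr0.
by move=> j _; rewrite mulr_suml; apply: eq_bigr => a _; ring.
Qed.

Lemma dotp_comb2 k (e : 'I_k -> 'I_n -> R) (u : 'I_k -> R) :
  orthonormal_in_kernel e ->
  \sum_j (\sum_a u a * e a j) ^+ 2 = \sum_a u a ^+ 2.
Proof.
move=> oe.
rewrite (eq_bigr (fun j => \sum_b u b * ((\sum_a u a * e a j) * e b j))).
  rewrite exchange_big/=; apply: eq_bigr => b _.
  by rewrite -mulr_sumr -/(dotp _ _) dotp_comb// -expr2.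
move=> j _; rewrite expr2 [in LHS]mulr_sumr; apply: eq_bigr => b _.
by rewrite mulrCA.
Qed.

(** With more than [q] independent kernel vectors, some nontrivial combination vanishes on the first
    [q] coordinates, contradicting the bound on zeros. This is how spreadness controls the dimension
    of the kernel. *)
Lemma orthonormal_in_kernel_bound (q k : nat) (e : 'I_k -> 'I_n -> R) :
  (0 < n)%N -> (q <= n)%N ->
  (forall z, in_kernel A z -> \sum_j z j ^+ 2 = n%:R ->
     (#|[set j | z j == 0%R]%SET| < q)%N) ->
  orthonormal_in_kernel e -> (k <= q)%N.
Proof.
move=> n0 qn sparse oe; rewrite leqNgt; apply/negP => qk.
pose M : 'M[R]_(k, q) := \matrix_(a, j) e a (widen_ord qn j).
have : kermx M != 0.
  rewrite kermx_eq0; apply/negP => /eqP rk.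
  by have := rank_leq_col M; rewrite rk leqNgt qk.
move=> /rowV0Pn[u /sub_kermxP uM u0].
pose x j := \sum_a u 0 a * e a j.
have xx : \sum_j x j ^+ 2 = \sum_a u 0 a ^+ 2 by rewrite dotp_comb2.
have xpos : 0 < \sum_j x j ^+ 2.
  rewrite lt_neqAle sumr_ge0 ?andbT; last by move=> j _; exact: sqr_ge0.
  rewrite eq_sym; apply: contra u0; rewrite xx psumr_eq0; last first.
    by move=> a _; exact: sqr_ge0.
  move=> /allP h; apply/eqP/rowP => a; rewrite mxE.
  by have := h a (mem_index_enum a); rewrite sqrf_eq0 => /eqP.
pose c := Num.sqrt (n%:R / \sum_j x j ^+ 2).
have c2 : c ^+ 2 = n%:R / \sum_j x j ^+ 2.
  by rewrite sqr_sqrtr// divr_ge0// ltW.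
have kx : in_kernel A (fun j => c * x j).
  by apply: in_kernelZ; apply: in_kernel_comb; exact: oe.1.
have nx : \sum_j (c * x j) ^+ 2 = n%:R.
  rewrite (eq_bigr (fun j => c ^+ 2 * x j ^+ 2)); last by move=> j _; rewrite exprMn.
  by rewrite -mulr_sumr c2 divfK// gt_eqF.
have := sparse _ kx nx; apply/negP; rewrite -leqNgt.
have winj : injective (widen_ord qn) by move=> a b /(congr1 val) /= /val_inj.
rewrite -[leqLHS]card_ord -(card_imset predT winj).
apply: subset_leq_card; apply/fintype.subsetP => _ /imsetP[j _ ->].
rewrite inE; apply/eqP; suff -> : x (widen_ord qn j) = 0 by rewrite mulr0.
have /matrixP/(_ 0 j) := uM; rewrite !mxE => <-.
by apply: eq_bigr => a _; rewrite mxE.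
Qed.

(** Orthonormal families in the kernel have bounded size, so one that cannot be enlarged exists; a
    kernel vector outside its span would enlarge it by a Gram-Schmidt step. *)
Lemma kernel_orthonormal_basis (q : nat) :
  (0 < n)%N -> (q <= n)%N ->
  (forall z, in_kernel A z -> \sum_j z j ^+ 2 = n%:R ->
     (#|[set j | z j == 0%R]%SET| < q)%N) ->
  exists k (e : 'I_k -> 'I_n -> R), [/\ (k <= q)%N, orthonormal_in_kernel e &
    forall z, in_kernel A z -> forall j, z j = \sum_a dotp z (e a) * e a j].
Proof.
move=> n0 qn sparse.
have [k [e [oe emax]]] : exists k (e : 'I_k -> 'I_n -> R), orthonormal_in_kernel e /\
    ~ exists e' : 'I_k.+1 -> 'I_n -> R, orthonormal_in_kernel e'.
  apply: contrapT => h.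
  have fam k : exists e : 'I_k -> 'I_n -> R, orthonormal_in_kernel e.
    elim: k => [|k [e oe]]; first by exists (fun _ _ => 0); split => -[].
    by apply: contrapT => h'; apply: h; exists k, e.
  have [e oe] := fam q.+1.
  by have := orthonormal_in_kernel_bound n0 qn sparse oe; rewrite ltnn.
exists k, e; split => //; first exact: orthonormal_in_kernel_bound oe.
move=> z kz.
pose y j := z j - \sum_a dotp z (e a) * e a j.
have ky : in_kernel A y.
  move=> i; rewrite (eq_bigr (fun j => A (i, j) * z j -
      A (i, j) * (\sum_a dotp z (e a) * e a j))); last by move=> j _; rewrite mulrBr.
  by rewrite big_split/= sumrN kz (in_kernel_comb _ oe.1) subrr.
have ye b : dotp y (e b) = 0.
  rewrite /dotp (eq_bigr (fun j => z j * e b j -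
      (\sum_a dotp z (e a) * e a j) * e b j)); last by move=> j _; rewrite mulrBl.
  by rewrite big_split/= sumrN -!/(dotp _ _) dotp_comb// subrr.
have [y0|y0] := eqVneq (dotp y y) 0.
  by move=> j; apply/eqP; rewrite -subr_eq0; apply/eqP; exact: dotp_eq0 y0 j.
exfalso; apply: emax.
have ypos : 0 < dotp y y by rewrite lt_neqAle eq_sym y0 dotp_ge0.
pose s := (Num.sqrt (dotp y y))^-1.
have s2 : s * s * dotp y y = 1.
  by rewrite -expr2 exprVn sqr_sqrtr ?ltW// mulVf.
pose y1 j := s * y j.
have y1e b : dotp y1 (e b) = 0.
  rewrite /dotp (eq_bigr (fun j => s * (y j * e b j))); last by move=> j _; rewrite mulrA.
  by rewrite -mulr_sumr -/(dotp _ _) ye mulr0.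
have y1y1 : dotp y1 y1 = 1.
  rewrite -s2 /dotp mulr_sumr; apply: eq_bigr => j _; rewrite /y1; ring.
have dotC u v : dotp u v = dotp v u by apply: eq_bigr => j _; rewrite mulrC.
exists (fun a => if unlift ord_max a is Some b then e b else y1); split.
  move=> a; case: unliftP => [b _|_]; first exact: oe.1.
  exact: in_kernelZ.
move=> a b; case: unliftP => [a' ->|->]; case: unliftP => [b' ->|->].
- by rewrite oe.2 (inj_eq lift_inj).
- by rewrite dotC y1e eq_sym eq_liftF.
- by rewrite y1e eq_liftF.
- by rewrite y1y1 eqxx.
Qed.

Lemma kernel_net (q : nat) (t : R) :
  (0 < n)%N -> (q <= n)%N -> 0 < t ->
  (forall z, in_kernel A z -> \sum_j z j ^+ 2 = n%:R ->
     (#|[set j | z j == 0%R]%SET| < q)%N) ->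
  exists (V : finType) (Q : pred V) (pt : V -> 'I_n -> R),
    \sum_(v | Q v) 1 <= expR (q%:R * (t^-1 + 2)) /\
    forall z, in_kernel A z -> \sum_j z j ^+ 2 = n%:R ->
      exists2 v, Q v & \sum_j (z j - pt v j) ^+ 2 <= t ^+ 2 * n%:R.
Proof.
move=> n0 qn t0 sparse.
have [k [e [kq oe espan]]] := kernel_orthonormal_basis n0 qn sparse.
have n0' : 0 < n%:R :> R by rewrite ltr0n.
(* Rounding k coefficients to multiples of [h] costs at most k h^2 = t^2 n in squared norm. *)
pose h : R := t * Num.sqrt (n%:R / k%:R).
exists {ffun 'I_k -> 'I_(lattice_radius k t).+1 * bool}.
exists (fun v : {ffun 'I_k -> 'I_(lattice_radius k t).+1 * bool} => (\sum_i ((v i).1 : nat)%:R <= k%:R / t) &&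
  (#|[set i | ((v i).1 : nat) != 0%N]%SET| <= k)%N).
exists (fun (v : {ffun 'I_k -> 'I_(lattice_radius k t).+1 * bool}) j => \sum_a (h * lattice_val (v a)) * e a j); split.
  (* With a = Y = 1 the sparsity bound is vacuous and only the l_1 budget k/t counts. *)
  apply: le_trans (lattice_count k _ k (k%:R / t) ltr01 (lexx _) _) _.
    by rewrite invr1.
  rewrite mul1r expr1n mulr1.
  have four : 4 ^+ k <= expR 2 ^+ k :> R := expr4_le_expR k.
  apply: (@le_trans _ _ (expR (k%:R / t) * expR 2 ^+ k)).
    by rewrite ler_wpM2l ?expR_ge0.
  rewrite -expRM_natl -expRD ler_expR -mulrDr ler_wpM2r ?ler_nat//.
  by rewrite addr_ge0// invr_ge0 ltW.
move=> z kz zn.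
pose u a := dotp z (e a).
have zE j : z j = \sum_a u a * e a j by exact: espan.
have un : \sum_a u a ^+ 2 = n%:R.
  by rewrite -zn -(dotp_comb2 u oe); apply: eq_bigr => j _; rewrite -zE.
have k0 : (0 < k)%N.
  rewrite lt0n; apply/negP => /eqP k0; move: un.
  rewrite big1; last by move=> a _; have := ltn_ord a; rewrite {2}k0.
  by move/eqP; rewrite eq_sym gt_eqF.
have k0' : 0 < k%:R :> R by rewrite ltr0n.
have h0 : 0 < h by rewrite mulr_gt0// sqrtr_gt0 divr_gt0.
have h2 : h ^+ 2 = t ^+ 2 * n%:R / k%:R.
  by rewrite exprMn sqr_sqrtr ?mulrA// divr_ge0 // ltW.
pose x a := u a / h.
have xn : \sum_a x a ^+ 2 = k%:R / t ^+ 2.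
  rewrite (eq_bigr (fun a => u a ^+ 2 / h ^+ 2)); last by move=> a _; rewrite expr_div_n.
  by rewrite -mulr_suml un h2; field; rewrite !gt_eqF.
have sx : \sum_a `|x a| <= k%:R / t.
  apply: (@le_trans _ _ (\sum_a (t * x a ^+ 2 + t^-1) / 2)).
    apply: ler_sum => a _.
    have : 0 <= (t * `|x a| - 1) ^+ 2 / t by rewrite divr_ge0 ?sqr_ge0// ltW.
    have -> : (t * `|x a| - 1) ^+ 2 / t = t * `|x a| ^+ 2 + t^-1 - 2 * `|x a|.
      by field; rewrite gt_eqF.
    by rewrite real_normK ?num_real//; lra.
  rewrite -mulr_suml big_split/= -mulr_sumr xn sumr_const card_ord.
  rewrite -[t^-1 *+ k]mulr_natl.
  have -> : t * (k%:R / t ^+ 2) = k%:R / t by field; rewrite gt_eqF.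
  by lra.
pose kk a := Num.truncn `|x a|.
have kt a : (kk a)%:R <= `|x a| < (kk a).+1%:R by rewrite /kk truncn_itv.
have kN a : (kk a < (lattice_radius k t).+1)%N.
  rewrite /lattice_radius ltnS; apply/leqW; apply: le_truncn.
  apply: le_trans sx; rewrite (bigD1 a)//= lerDl.
  by apply: sumr_ge0.
pose v : {ffun 'I_k -> 'I_(lattice_radius k t).+1 * bool} :=
  [ffun a => (Ordinal (kN a), 0 <= x a)].
have dv a : `|x a - lattice_val (v a)| <= 1.
  have [h1 h3] := andP (kt a); move: h1 h3; rewrite /lattice_val ffunE/= -addn1 natrD.
  case: (lerP 0 (x a)) => hx.
    by rewrite mul1r (ger0_norm hx) ler_norml; lra.
  by rewrite mulN1r opprK (ltr0_norm hx) ler_norml; lra.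
exists v.
  apply/andP; split; last by apply: leq_trans (max_card _) _; rewrite card_ord.
  apply: le_trans sx; apply: ler_sum => a _; rewrite ffunE/=.
  by have [] := andP (kt a).
rewrite (eq_bigr (fun j => (\sum_a (h * (x a - lattice_val (v a))) * e a j) ^+ 2)); last first.
  move=> j _; congr (_ ^+ 2); rewrite zE -sumrB; apply: eq_bigr => a _.
  have -> : u a = h * x a by rewrite /x mulrC divfK ?gt_eqF.
  by move: (lattice_val _) => l; ring.
rewrite dotp_comb2//.
rewrite (eq_bigr (fun a => h ^+ 2 * (x a - lattice_val (v a)) ^+ 2)); last first.
  by move=> a _; rewrite exprMn.
rewrite -mulr_sumr h2.
apply: (@le_trans _ _ (t ^+ 2 * n%:R / k%:R * k%:R)); last by rewrite divfK ?gt_eqF.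
have c0 : 0 <= t ^+ 2 * n%:R / k%:R by rewrite -h2 sqr_ge0.
apply: ler_wpM2l => //.
apply: (@le_trans _ _ (\sum_(a : 'I_k) 1)); last by rewrite sumr_const card_ord.
apply: ler_sum => a _.
by rewrite -real_normK ?num_real//; apply: exprn_ile1.
Qed.

End KernelNet.

(** * Bad colourings *)

Section BadColours.
Context {R : realType}.
Variables (C : finType) (w : C -> R) (H : C -> R -> R).

(** A zero sum counts as bad because the minimiser has to be unique. *)
Definition bad_colouring m n (A : 'I_m * 'I_n -> R) (c : {ffun 'I_n -> C}) : Prop :=
  exists z, [/\ in_kernel A z, \sum_j z j ^+ 2 = n%:R & \sum_j H (c j) (z j) <= 0].

Lemma sum_sqr_le2 n (x y : 'I_n -> R) :
  \sum_j y j ^+ 2 <= 2 * \sum_j x j ^+ 2 + 2 * \sum_j (x j - y j) ^+ 2.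
Proof.
rewrite !mulr_sumr -big_split/=; apply: ler_sum => j _.
have := sqr_ge0 (2 * x j - y j).
rewrite -subr_ge0 => h; rewrite -subr_ge0.
by move: h; congr (_ <= _); ring.
Qed.

(** At a kernel vector the mean of the profile sum is at least (a - (a + b) kap) n >= 4 nu n, the
    share kap of small coordinates contributing at least -b each. Moving to a net point changes sums
    and means by at most nu n. A bad colouring therefore forces, at some net point, a sum of at most
    nu n against a mean of at least 3 nu n. *)
Lemma bad_colouring_weight m n (A : 'I_m * 'I_n -> R) (q : nat)
    (nu t a b r kap : R) :
  (0 < n)%N -> (q <= n)%N -> 0 < t -> t <= 1 -> 0 < nu -> 0 <= a -> 0 <= b ->
  (forall c, 0 <= w c) -> \sum_c w c = 1 ->
  (forall c x y, `|H c x - H c y| <= nu / 2 * (1 + ((x - y) / t) ^+ 2)) ->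
  (forall c x, H c x ^+ 2 <= 1 + x ^+ 2) ->
  (forall x, - b <= \sum_c w c * H c x) ->
  (forall x, r < `|x| -> a <= \sum_c w c * H c x) ->
  4 * nu <= a - (a + b) * kap ->
  (forall z, in_kernel A z -> \sum_j z j ^+ 2 = n%:R ->
     (#|[set j | z j == 0%R]%SET| < q)%N) ->
  (forall z, in_kernel A z -> \sum_j z j ^+ 2 = n%:R ->
     (#|[set j | `|z j| <= r]%SET|)%:R <= kap * n%:R) ->
  \sum_(c : {ffun 'I_n -> C} | `[< bad_colouring A c >]) colour_weight w c <=
    expR (q%:R * (t^-1 + 2) - n%:R * (nu ^+ 2 / 20)).
Proof.
move=> n0 qn t0 t1 nu0 a0 b0 w0 w1 HL H2 Hm1 Hma hnu sparse spread.
have n0' : 0 < n%:R :> R by rewrite ltr0n.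
have [V [Q [pt [cQ net]]]] := kernel_net n0 qn t0 sparse.
pose near v z := [/\ in_kernel A z, \sum_j z j ^+ 2 = n%:R &
  \sum_j (z j - pt v j) ^+ 2 <= t ^+ 2 * n%:R].
have dist v z : near v z ->
    \sum_j nu / 2 * (1 + ((z j - pt v j) / t) ^+ 2) <= nu * n%:R.
  move=> [_ _ d]; rewrite -mulr_sumr big_split/= sumr_const card_ord.
  rewrite (eq_bigr (fun j => (z j - pt v j) ^+ 2 / t ^+ 2)); last first.
    by move=> j _; rewrite expr_div_n.
  rewrite -mulr_suml.
  have : (\sum_j (z j - pt v j) ^+ 2) / t ^+ 2 <= n%:R.
    by rewrite ler_pdivrMr ?exprn_gt0// mulrC.
  set S := _ / _ => hS; have := ler_wpM2l (ltW nu0) hS.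
  rewrite -[1 *+ n]/(n%:R); lra.
have one v : (exists z, near v z) ->
    \sum_(c : {ffun 'I_n -> C} | \sum_j H (c j) (pt v j) <= nu * n%:R)
       colour_weight w c <= expR (- (n%:R * (nu ^+ 2 / 20))).
  move=> [z nvz]; have [kz zn d] := nvz.
  have dd := dist v z nvz.
  pose B (j : 'I_n) := Num.sqrt (1 + pt v j ^+ 2).
  have Hb j c : `|H c (pt v j)| <= B j.
    by rewrite /B -sqrtr_sqr ler_sqrt ?H2// addr_ge0 ?sqr_ge0.
  (* With the squared bounds summing to at most 5n, the exponent is n (-2 nu l + 20 l^2), minimal at
     this [l]. *)
  pose l := nu / 20.
  have l0 : 0 <= l by rewrite divr_ge0 // ltW.
  apply: le_trans (colour_chernoff (nu * n%:R) w0 w1 Hb l0) _.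
  rewrite ler_expR.
  have Sb : \sum_j B j ^+ 2 <= 5 * n%:R.
    rewrite (eq_bigr (fun j => 1 + pt v j ^+ 2)); last first.
      by move=> j _; rewrite sqr_sqrtr// addr_ge0 ?sqr_ge0.
    rewrite big_split/= sumr_const card_ord -[1 *+ n]/(n%:R).
    have := sum_sqr_le2 z (pt v); rewrite zn.
    have : t ^+ 2 * n%:R <= n%:R.
      by rewrite ler_piMl//; apply: exprn_ile1 => //; exact: ltW.
    by lra.
  have mz : 4 * nu * n%:R <= \sum_j \sum_c w c * H c (z j).
    pose J := [set j | `|z j| <= r]%SET.
    apply: (@le_trans _ _ (\sum_j (if j \in J then - b else a))).
      rewrite (eq_bigr (fun j => a - (if j \in J then a + b else 0))); last first.
        by move=> j _; case: ifP => _; ring.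
      rewrite sumrB sumr_const card_ord -big_mkcond/= sumr_const.
      have hJ : (#|J|)%:R <= kap * n%:R by exact: spread.
      rewrite -[a *+ n]mulr_natr -[(a + b) *+ _]mulr_natr.
      have g1 : (a + b) * (#|J|)%:R <= (a + b) * (kap * n%:R) by rewrite ler_wpM2l// addr_ge0.
      have g2 : 4 * nu * n%:R <= (a - (a + b) * kap) * n%:R by rewrite ler_wpM2r.
      by move: g1 g2; rewrite mulrBl mulrA; lra.
    apply: ler_sum => j _; rewrite inE; case: ifP => // /negbT.
    by rewrite -ltNge => /Hma.
  have mq : 3 * nu * n%:R <= \sum_j \sum_c w c * H c (pt v j).
    have : \sum_j \sum_c w c * H c (z j) - \sum_j \sum_c w c * H c (pt v j) <= nu * n%:R.
      apply: le_trans dd; rewrite -sumrB; apply: ler_sum => j _.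
      rewrite -sumrB -[leRHS]mul1r -[X in X * _]w1 mulr_suml; apply: ler_sum => c _.
      by rewrite -mulrBr ler_wpM2l//; apply: le_trans (ler_norm _) (HL c _ _).
    by lra.
  have h1 : l * (3 * nu * n%:R) <= l * (\sum_j \sum_c w c * H c (pt v j)).
    by rewrite ler_wpM2l.
  have h2 : 4 * l ^+ 2 * (\sum_j B j ^+ 2) <= 4 * l ^+ 2 * (5 * n%:R).
    by rewrite ler_wpM2l// mulr_ge0 ?sqr_ge0.
  have -> : - (n%:R * (nu ^+ 2 / 20)) =
      l * (nu * n%:R) - l * (3 * nu * n%:R) + 4 * l ^+ 2 * (5 * n%:R).
    by rewrite /l; field.
  by lra.
(* The mean is bounded below only near kernel vectors, so other net points are discarded. *)
pose Q' v := Q v && `[< exists z, near v z >].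
apply: (@le_trans _ _ (\sum_(v | Q' v)
  \sum_(c : {ffun 'I_n -> C} | \sum_j H (c j) (pt v j) <= nu * n%:R) colour_weight w c)).
  rewrite (exchange_big_dep xpredT)//=.
  rewrite big_mkcond/=; apply: ler_sum => c _.
  have cw := colour_weight_ge0 c w0.
  case: ifPn => [/asboolP[z [kz zn hz]]|_]; last by apply: sumr_ge0.
  have [v Qv d] := net z kz zn.
  have nvz : near v z by [].
  rewrite (bigD1 v)/=; last first.
    rewrite /Q' Qv/=; apply/andP; split; first by apply/asboolP; exists z.
    have : \sum_j H (c j) (pt v j) - \sum_j H (c j) (z j) <= nu * n%:R.
      apply: le_trans (dist v z nvz); rewrite -sumrB; apply: ler_sum => j _.
      by apply: le_trans (ler_norm _) _; rewrite distrC; exact: HL.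
    by lra.
  by rewrite lerDl; apply: sumr_ge0.
apply: (@le_trans _ _ (\sum_(v | Q v) expR (- (n%:R * (nu ^+ 2 / 20))))).
  rewrite big_mkcond/= [leRHS]big_mkcond/=; apply: ler_sum => v _.
  rewrite /Q'; case: (Q v) => //=; case: ifPn => [/asboolP/one //|_].
  exact: expR_ge0.
rewrite expRD.
rewrite (eq_bigr (fun v => 1 * expR (- (n%:R * (nu ^+ 2 / 20))))); last first.
  by move=> v _; rewrite mul1r.
by rewrite -mulr_suml ler_wpM2r ?expR_ge0.
Qed.

End BadColours.

(** * Measurability of the failure event *)

Section BadColouringMeasurable.
Context {R : realType}.

Lemma continuous_sum (T : topologicalType) (I : finType) (f : I -> T -> R) :
  (forall i, continuous (f i)) -> continuous (fun x => \sum_i f i x).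
Proof.
move=> cf x; elim: (index_enum I) => [|i r IH].
  under eq_fun do rewrite big_nil.
  exact: cvg_cst.
under eq_fun do rewrite big_cons.
by apply: cvgD => //; exact: cf.
Qed.

Lemma continuous_add (T : topologicalType) (f g : T -> R) :
  continuous f -> continuous g -> continuous (fun x => f x + g x).
Proof. by move=> cf cg x; apply: cvgD; [exact: cf|exact: cg]. Qed.

Lemma continuous_mul (T : topologicalType) (f g : T -> R) :
  continuous f -> continuous g -> continuous (fun x => f x * g x).
Proof. by move=> cf cg x; apply: cvgM; [exact: cf|exact: cg]. Qed.

Lemma continuous_abs (T : topologicalType) (f : T -> R) :
  continuous f -> continuous (fun x => `|f x|).
Proof. by move=> cf x; apply: cvg_norm; exact: cf. Qed.

(** The points [u k] stay in a compact box and have a cluster point, where continuity forces f <=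
    0. *)
Lemma small_values_box_zero n (M : R) (f : 'rV[R]_n -> R) : continuous f ->
  (forall k : nat, exists2 v : 'rV[R]_n, (forall j, `|v 0 j| <= M) & f v <= k.+1%:R^-1) ->
  exists v, f v <= 0.
Proof.
move=> cf h.
have /choice[u hu] : forall k : nat, exists v : 'rV[R]_n,
    (forall j, `|v 0 j| <= M) /\ f v <= k.+1%:R^-1.
  by move=> k; have [v h1 h2] := h k; exists v.
have uM k := (hu k).1; have fu k := (hu k).2.
pose K := [set v : 'rV[R]_n | forall j, `[- M, M]%classic (v ord0 j)].
have cK : compact K.
  apply: (@rV_compact _ _ (fun=> `[- M, M]%classic)) => j.
  exact: segment_compact.
have uK : \forall k \near \oo, K (u k).
  by near=> k => j /=; rewrite in_itv/= -ler_norml; exact: uM.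
have [v [_ clv]] := cK (u @ \oo) _ uK.
exists v; rewrite leNgt; apply/negP => fv.
have fv2 : f v / 2 < f v by lra.
have nv : nbhs v [set x | f v / 2 < f x].
  exact: (cvgr_gt _ (cf v)).
have nu : \forall k \near \oo, f (u k) < f v / 2.
  have h0 : 0 < f v / 2 by lra.
  near=> k => /=; apply: le_lt_trans (fu k) _.
  by near: k; apply: near_infty_natSinv_lt (PosNum h0).
have [x [/= h1 h2]] := clv [set x | f x < f v / 2] _ nu nv.
by have := lt_trans h1 h2; rewrite ltxx.
Unshelve. all: by end_near. Qed.

Lemma rational_approx n (f : 'rV[R]_n -> R) (v : 'rV[R]_n) (e : R) :
  continuous f -> 0 < e ->
  exists2 q : 'rV[rat]_n, f (map_mx ratr q) < f v + e &
    forall j, `|ratr (q 0 j) : R| <= `|v 0 j| + 1.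
Proof.
move=> cf e0.
have : nbhs v [set x | f x < f v + e].
  by apply: (cvgr_lt _ (cf v)); rewrite ltrDl.
move=> /nbhs_ballP[r /= r0 hr].
have ex j : exists q : rat, `|v 0 j - ratr q| < r /\ `|ratr q : R| <= `|v 0 j| + 1.
  pose r' := Num.min r 1.
  have r'0 : 0 < r' by rewrite lt_min r0 ltr01.
  have /rat_in_itvoo[q] : v 0 j < v 0 j + r' by rewrite ltrDl.
  rewrite in_itv/= => /andP[h1 h2].
  have h3 : `|v 0 j - ratr q| < r' by rewrite distrC gtr0_norm ?subr_gt0// ltrBlDl.
  exists q; split; first by apply: lt_le_trans h3 _; rewrite ge_min lexx.
  rewrite -lerBlDl; apply: le_trans (lerB_dist _ _) _.
  by rewrite distrC; apply: le_trans (ltW h3) _; rewrite ge_min lexx orbT.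
have [q hq] := choice ex.
exists (\row_j q j); last by move=> j; rewrite mxE; exact: (hq j).2.
apply: hr; split => // i j; rewrite (ord1 i) !mxE.
exact: (hq j).1.
Qed.

(** The event is an existential over uncountably many z. By compactness and continuity it is
    equivalent to having, for every k, a rational point in a fixed box that violates the constraints
    by at most 1/(k+1), which is a countable combination. *)
Lemma measurable_bad_colouring (C : finType) (H : C -> R -> R) m n (c : {ffun 'I_n -> C}) :
  (forall i, continuous (H i)) ->
  measurable ([set A | bad_colouring H A c] : set (coords R ('I_m * 'I_n)%type)).
Proof.
move=> cH.
pose g (v : 'rV[R]_n) : R := \sum_j H (c j) (v 0 j).
pose s (v : 'rV[R]_n) : R := \sum_j v 0 j ^+ 2 - n%:R.
(* [f A] is a nonnegative penalty vanishing exactly at the witnesses; g + |g| is twice the positive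
   part of g. *)
pose p (v : 'rV[R]_n) : R := `|s v| + (g v + `|g v|).
pose f (A : 'I_m * 'I_n -> R) (v : 'rV[R]_n) : R := image_sqr A (v 0) + p v.
have cc j : continuous (fun v : 'rV[R]_n => v 0 j) by exact: coord_continuous.
have cg : continuous g.
  by apply: continuous_sum => j v; apply: (continuous_comp (cc j v)); exact: cH.
have cs : continuous s.
  apply: continuous_add; last exact: cst_continuous.
  by apply: continuous_sum => j; apply: continuous_mul; exact: cc.
have cp : continuous p.
  apply: continuous_add; first exact: continuous_abs.
  by apply: continuous_add => //; exact: continuous_abs.
have cf A : continuous (f A).
  apply: continuous_add => //; apply: continuous_sum => i.
  by apply: continuous_mul; apply: continuous_sum => j;
    apply: continuous_mul; [exact: cst_continuous|exact: cc|exact: cst_continuous|exact: cc].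
have gg v : 0 <= g v + `|g v| by have := ler_norm (- g v); rewrite normrN; lra.
have p0 v : 0 <= p v by apply: addr_ge0; [exact: normr_ge0|exact: gg].
have im0 (A : 'I_m * 'I_n -> R) (z : 'I_n -> R) : 0 <= image_sqr A z.
  by apply: sumr_ge0 => i _; exact: sqr_ge0.
have zeroP A : bad_colouring H A c <-> exists v, f A v <= 0.
  split=> [[z [kz zn hz]]|[v hv]].
    exists (\row_j z j); rewrite /f /p /s /g /image_sqr.
    have -> : \sum_j (\row_j z j) 0 j ^+ 2 = n%:R.
      by rewrite -zn; apply: eq_bigr => j _; rewrite mxE.
    have -> : \sum_j H (c j) ((\row_j z j) 0 j) = \sum_j H (c j) (z j).
      by apply: eq_bigr => j _; rewrite mxE.
    rewrite subrr normr0 add0r (ler0_norm hz) subrr addr0 big1// => i _.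
    by rewrite (eq_bigr (fun j => A (i, j) * z j)) ?kz ?expr0n// => j _; rewrite mxE.
  have pz : p v = 0 by apply/eqP; rewrite eq_le p0 andbT; have := im0 A (v 0); move: hv; rewrite /f; lra.
  have iz : image_sqr A (v 0) = 0.
    by apply/eqP; rewrite eq_le im0 andbT; move: hv; rewrite /f pz addr0.
  have sz : s v = 0.
    apply/normr0_eq0/eqP; rewrite eq_le normr_ge0 andbT.
    have := gg v.
    by move: pz; rewrite /p; lra.
  exists (v 0); split.
  - move=> i; move/eqP: iz; rewrite psumr_eq0; last by move=> ? _; exact: sqr_ge0.
    by move=> /allP/(_ i (mem_index_enum i)); rewrite sqrf_eq0 => /eqP.
  - by apply/eqP; rewrite -subr_eq0; apply/eqP.
  - have := normr_ge0 (g v); have := normr_ge0 (s v).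
    by move: pz; rewrite /p /g; lra.
(* The coordinates of a witness are at most n + 1, and the rational approximation adds at most 1. *)
pose D := fun (k : nat) (q : 'rV[rat]_n) =>
  [set A : coords R ('I_m * 'I_n)%type |
    (forall j, `|ratr (q 0 j) : R| <= n%:R + 2) /\
    f A (map_mx ratr q) <= k.+1%:R^-1].
rewrite (_ : mkset _ = \bigcap_k \bigcup_q D k q).
  apply: bigcapT_measurable => k; apply: countable_bigcupT_measurable => [|q].
    exact: countableP.
  have [h|h] := pselect (forall j, `|ratr (q 0 j) : R| <= n%:R + 2); last first.
    by rewrite (_ : D k q = set0)//; apply/seteqP; split => // A [].
  rewrite (_ : D k q = [set A | f A (map_mx ratr q) <= k.+1%:R^-1]).
    apply: measurable_set_le => //.
    apply: (measurable_funD (measurable_image_sqr _)) => //.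
  by apply/seteqP; split => // A [].
apply/seteqP; split=> [A /= /zeroP[v hv] k _|A /= h].
  have k0 : 0 < k.+1%:R^-1 :> R by rewrite invr_gt0.
  have [q hq qb] := rational_approx v (cf A) k0.
  exists q => //; split; last by apply: ltW; apply: lt_le_trans hq _; rewrite gerDr.
  move=> j; apply: le_trans (qb j) _.
  have : s v = 0.
    apply/normr0_eq0/eqP; rewrite eq_le normr_ge0 andbT.
    have := gg v.
    by have := im0 A (v 0); move: hv; rewrite /f /p; lra.
  move=> /subr0_eq sv.
  have : `|v 0 j| ^+ 2 <= n%:R.
    rewrite real_normK ?num_real// -sv (bigD1 j)//= lerDl.
    by apply: sumr_ge0 => i _; exact: sqr_ge0.
  have := sqr_ge0 (`|v 0 j| - 2^-1).
  by rewrite !expr2; set x := `|_|; nra.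
apply/zeroP; apply: (@small_values_box_zero n (n%:R + 2)) => // k.
by have [q _ [qb fq]] := h k Logic.I; exists (map_mx ratr q) => // j; rewrite mxE.
Qed.

End BadColouringMeasurable.

(** * Averaging over signed permutations of the columns *)

Section Symmetry.
Context {R : realType}.

Lemma normal_prob_opp (B : set R) : measurable B ->
  normal_prob 0 1 (-%R @^-1` B) = normal_prob 0 1 B :> \bar R.
Proof.
move=> mB.
have mo : measurable_fun [set: measurableTypeR R] (-%R : _ -> measurableTypeR R).
  exact: oppr_measurable.
rewrite /normal_prob.
have mf : measurable_fun [set: measurableTypeR R]
    (fun x : measurableTypeR R => (normal_pdf 0 1 x)%:E).
  by apply/measurable_EFinP; exact: measurable_normal_pdf.
transitivity (\int[pushforward lebesgue_measure (-%R : _ -> measurableTypeR R)]_(x in B)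
   (normal_pdf 0 1 x)%:E)%E.
  rewrite ge0_integral_pushforward//=.
  - apply: eq_integral => x _ /=; congr (_%:E).
    by rewrite !normal_pdfE ?oner_eq0// /normal_fun !subr0 sqrrN.
  - exact: measurable_funTS.
  - by move=> x _; rewrite lee_fin normal_pdf_ge0.
by apply: eq_measure_integral => A mA _; exact: lebesgue_measureN.
Qed.

Lemma gaussian_family_signed_perm (I : finType) d (T : measurableType d)
    (P : probability T R) (G : I -> T -> R) (s : {perm I}) (e : I -> bool) :
  gaussian_family P G ->
  gaussian_family P (fun k w => (-1) ^+ e k * G (s k) w).
Proof.
move=> [indG stdG].
pose F k (B : set R) := if e k then -%R @^-1` B else B.
have mF k B : measurable B -> measurable (F k B).
  move=> mB; rewrite /F; case: (e k) => //.
  by rewrite -[_ @^-1` _]setTI; exact: oppr_measurable.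
have preF k B : (fun w => (-1) ^+ e k * G (s k) w) @^-1` B = G (s k) @^-1` F k B.
  apply/seteqP; split => w /=; rewrite /F; case: (e k);
    by rewrite ?expr1 ?expr0 ?mul1r ?mulN1r.
have margF k B : measurable B -> P (G (s k) @^-1` F k B) = normal_prob 0 1 B.
  move=> mB; rewrite (stdG (s k)).2; last exact: mF.
  by rewrite /F; case: (e k) => //; exact: normal_prob_opp.
split; last first.
  move=> k; split; last by move=> B mB; rewrite preF; exact: margF.
  apply: (@measurable_funM _ _ R setT (cst _) (G (s k))) => //.
  exact: (stdG (s k)).1.
move=> B mB.
have -> : \bigcap_(k in [set: I]) ((fun w => (-1) ^+ e k * G (s k) w) @^-1` B k) =
    \bigcap_(k in [set: I]) (G k @^-1` F ((s^-1)%g k) (B ((s^-1)%g k))).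
  apply/seteqP; split => w /= h k _.
    by have := h ((s^-1)%g k) Logic.I; rewrite preF permKV.
  by have := h (s k) Logic.I; rewrite preF permK.
rewrite indG; last by move=> k; exact: mF.
rewrite (reindex_inj (@perm_inj _ s))/=; apply: eq_bigr => k _.
by rewrite permK preF.
Qed.

(** Take a permutation sending as few elements of [A] as possible outside [B]. If some image [s i]
    is outside, counting yields u in [B] not reached from [A], and exchanging [s i] with u does
    better. *)
Lemma perm_into (I : finType) (A B : {set I}) : (#|A| <= #|B|)%N ->
  exists s : {perm I}, forall i, i \in A -> s i \in B.
Proof.
move=> AB.
pose f (s : {perm I}) := #|[set i in A | s i \notin B]%SET|.
have [s _ smin] : exists2 s : {perm I}, true & forall t, (f s <= f t)%N.
  by case: (@arg_minnP _ 1%g xpredT f) => // s _ h; exists s => // t; exact: h.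
exists s => i iA; apply/negPn/negP => siB.
have [u uB uA] : exists2 u, u \in B & (s^-1)%g u \notin A.
  apply/exists_inP; apply: contraLR AB; rewrite negb_exists_in => /forall_inP h.
  have sub : [set (s^-1)%g u | u in B]%SET \subset A :\ i.
    apply/fintype.subsetP => _ /imsetP[u uB ->]; rewrite !inE.
    apply/andP; split; last by have := h u uB; rewrite negbK.
    by apply: contraNneq siB => <-; rewrite permKV.
  have := subset_leq_card sub; rewrite card_imset; last exact: perm_inj.
  rewrite -ltnNge => /leq_ltn_trans; apply.
  by rewrite [X in (_ < X)%N](cardsD1 i) iA.
have := smin (s * tperm (s i) u)%g; rewrite leqNgt => /negP; apply.
apply: proper_card; apply/properP; split.
  apply/fintype.subsetP => j; rewrite !inE permM => /andP[jA].
  case: tpermP => [sj|sj|_ _] h.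
  - by rewrite uB in h.
  - by move: uA; rewrite -sj permK jA.
  - by rewrite jA h.
by exists i; rewrite !inE ?iA// permM tpermL uB.
Qed.

(* The colour [None] stands for a coordinate off the support, [Some b] for a
   coordinate of the support, with positive sign iff [b]. *)
Variable H : option bool -> R -> R.
Hypothesis HSN : forall b x, H (Some b) (- x) = H (Some (~~ b)) x.
Hypothesis HSle : forall b x, H (Some b) x <= H None x.
Hypothesis Hc : forall i, continuous (H i).

Definition coloured n (c : {ffun 'I_n -> option bool}) : {set 'I_n} :=
  [set j | c j != None]%SET.

(** A permutation places the support of [c0] inside that of [c] and sign flips align the signs,
    neither changing the law of the matrix. Colouring further coordinates only lowers the profile
    sum, by [HSle]. *)
Lemma bad_colouring_prob_mono m n (c0 c : {ffun 'I_n -> option bool})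
    d (T : measurableType d) (P : probability T R) (G : 'I_m * 'I_n -> T -> R) :
  gaussian_family P G -> (#|coloured c0| <= #|coloured c|)%N ->
  (P [set w | bad_colouring H (G ^~ w) c0] <= P [set w | bad_colouring H (G ^~ w) c])%E.
Proof.
move=> gG c0c.
have [s hs] := perm_into c0c.
pose e j : bool := if (c0 j, c (s j)) is (Some b, Some b') then b != b' else false.
have He j x : H (c (s j)) ((-1) ^+ e j * x) <= H (c0 j) x.
  rewrite /e; case c0j : (c0 j) => [b|].
    have : s j \in coloured c by apply: hs; rewrite inE c0j.
    rewrite inE; case: (c (s j)) => // b' _.
    case: eqVneq => [->|bb']; first by rewrite expr0 mul1r.
    rewrite expr1 mulN1r HSN; have -> // : ~~ b' = b by move: bb'; clear; case: b; case: b'.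
  rewrite expr0 mul1r; case: (c (s j)) => [b|//]; exact: HSle.
have inj2 : injective (fun ik : 'I_m * 'I_n => (ik.1, s ik.2)).
  by move=> [i k] [i' k'] /= [-> /perm_inj ->].
(* The inverse makes column [s j] of [G'] equal to column [j] of [G] up to sign. *)
pose s2 := (perm inj2)^-1%g.
pose e2 (ik : 'I_m * 'I_n) := e ((s^-1)%g ik.2).
pose G' ik w := (-1) ^+ e2 ik * G (s2 ik) w.
have gG' : gaussian_family P G' by exact: gaussian_family_signed_perm.
have G'E i j w : G' (i, s j) w = (-1) ^+ e j * G (i, j) w.
  rewrite /G' /e2/= permK; congr (_ * G _ w).
  by apply: (@perm_inj _ (perm inj2)); rewrite permKV permE.
have mB c' : measurable ([set A | bad_colouring H A c'] : set (coords R ('I_m * 'I_n)%type)).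
  exact: measurable_bad_colouring.
have mG := gaussian_family_measurable gG.
have mG' := gaussian_family_measurable gG'.
have -> : P [set w | bad_colouring H (G ^~ w) c] = P [set w | bad_colouring H (G' ^~ w) c].
  exact: (gaussian_family_law gG gG' (mB c)).
have m1 : measurable [set w | bad_colouring H (G ^~ w) c0].
  by have := mG measurableT _ (mB c0); rewrite setTI.
have m2 : measurable [set w | bad_colouring H (G' ^~ w) c].
  by have := mG' measurableT _ (mB c); rewrite setTI.
apply: le_measure; [exact/mem_set|exact/mem_set|].
move=> w /= [z [kz zn hz]].
pose z' k := (-1) ^+ e ((s^-1)%g k) * z ((s^-1)%g k).
have z'E j : z' (s j) = (-1) ^+ e j * z j by rewrite /z' permK.
exists z'; split.
- move=> i; rewrite (reindex_inj (@perm_inj _ s))/= -[RHS](kz i).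
  apply: eq_bigr => j _; rewrite G'E z'E mulrACA -expr2 sqrr_sign mul1r//.
- rewrite (reindex_inj (@perm_inj _ s))/= -zn; apply: eq_bigr => j _.
  by rewrite z'E exprMn sqrr_sign mul1r.
- apply: le_trans hz; rewrite (reindex_inj (@perm_inj _ s))/=.
  by apply: ler_sum => j _; rewrite z'E.
Qed.

End Symmetry.

(** The average over colourings of the failure probability is the expected weight of the colourings
    that fail. That weight is at most [b] outside [N] and at most 1 on [N]. *)
Lemma averaged_prob_le d (T : measurableType d) (R : realType) (P : probability T R)
    (C : finType) (W : C -> R) (E : C -> set T) (N : set T) (b : R) :
  (forall c, 0 <= W c) -> \sum_c W c = 1 -> 0 <= b ->
  (forall c, measurable (E c)) -> measurable N ->
  (forall w, ~ N w -> \sum_(c | `[< E c w >]) W c <= b) ->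
  (\sum_c (W c)%:E * P (E c) <= b%:E + P N)%E.
Proof.
move=> W0 W1 b0 mE mN hN.
have -> : (\sum_c (W c)%:E * P (E c) = \int[P]_w (\sum_c (W c * \1_(E c) w)%:E))%E.
  rewrite ge0_integral_sum//.
  - apply: eq_bigr => c _; under eq_integral do rewrite EFinM.
    rewrite ge0_integralZl//.
    + by rewrite integral_indic// setIT.
    + exact/measurable_EFinP/measurable_indic.
    + by rewrite lee_fin.
  - move=> c; apply/measurable_EFinP.
    apply: (@measurable_funM _ _ R setT (cst (W c)) \1_(E c)) => //.
  - by move=> c w _; rewrite lee_fin mulr_ge0// indicE.
have -> : (b%:E + P N = \int[P]_w (b + \1_N w)%:E)%E.
  under eq_integral do rewrite EFinD.
  rewrite ge0_integralD//.
  - by rewrite integral_cst//= probability_setT mule1 integral_indic// setIT.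
  - exact/measurable_EFinP/measurable_indic.
apply: ge0_le_integral => //.
- by move=> w _; apply: sume_ge0 => c _; rewrite lee_fin mulr_ge0// indicE.
- apply: emeasurable_sum => c; apply/measurable_EFinP.
  exact: (@measurable_funM _ _ R setT (cst (W c)) \1_(E c)).
- apply/measurable_EFinP; apply: (@measurable_funD _ _ R setT (cst b) \1_N) => //.
move=> w _; rewrite sumEFin lee_fin.
have -> : \sum_c W c * \1_(E c) w = \sum_(c | `[< E c w >]) W c.
  rewrite [RHS]big_mkcond/=; apply: eq_bigr => c _; rewrite indicE.
  by case: asboolP => h; [rewrite mem_set//= mulr1|rewrite memNset// mulr0].
have [Nw|Nw] := pselect (N w).
  rewrite indicE mem_set//= (@le_trans _ _ 1)//; last by rewrite lerDr.
  by rewrite -W1 big_mkcond/=; apply: ler_sum => c _; case: ifP.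
by apply: le_trans (hN w Nw) _; rewrite lerDl indicE.
Qed.

(** * Constants for spreadness, and the trivial kernel of tall matrices *)

Section SpreadConstants.
Context {R : realType}.

(* The scale that [good_matrix_prob] provides for [b = k / 4]. *)
Definition spread_scale (k : R) : R := expR (- (9 + 14 / (k / 4))).
Definition spread_radius (k : R) : R := k / 8 * spread_scale k.
(** The share k of small coordinates is split as 3k/4, removed from the support here, and k/4 = 2
    (k/8), lost to coordinates of size below the radius that are still rounded away from 0. *)
Definition spread_size (k : R) (n : nat) : nat := (n - Num.truncn (3 / 4 * k * n%:R))%N.

Lemma spread_scale_gt0 (k : R) : 0 < spread_scale k. Proof. exact: expR_gt0. Qed.

Lemma expRN1_le_half : expR (- 1) <= 2^-1 :> R.
Proof.
rewrite expRN lef_pV2 ?posrE ?expR_gt0//.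
by apply: le_trans (expR_ge1Dx _); lra.
Qed.

Lemma spread_scale_le (k : R) : 0 < k -> spread_scale k <= 2^-1.
Proof.
move=> k0; apply: le_trans expRN1_le_half; rewrite ler_expR.
have : 0 <= 14 / (k / 4) by rewrite divr_ge0 ?divr_ge0 // ltW.
lra.
Qed.

Lemma spread_radius_gt0 (k : R) : 0 < k -> 0 < spread_radius k.
Proof. by move=> k0; rewrite mulr_gt0 ?spread_scale_gt0// divr_gt0. Qed.

Lemma spread_radius_le1 (k : R) : 0 < k -> k < 1 -> spread_radius k <= 1.
Proof.
move=> k0 k1; have h := spread_scale_le k0; have h0 := spread_scale_gt0 k.
rewrite /spread_radius; apply: mulr_ile1; rewrite ?(ltW h0)//; lra.
Qed.

Lemma truncn_spread (k : R) n : 0 < k ->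
  (Num.truncn (3 / 4 * k * n%:R))%:R <= 3 / 4 * k * n%:R /\
  3 / 4 * k * n%:R - 1 <= (Num.truncn (3 / 4 * k * n%:R))%:R.
Proof.
move=> k0; have h : 0 <= 3 / 4 * k * n%:R.
  by rewrite mulr_ge0// mulr_ge0// ltW.
have /andP[h1 h2] := truncn_itv h; split => //.
by move: h2; rewrite -[(Num.truncn (3 / 4 * k * n%:R)).+1]addn1 natrD; lra.
Qed.

Lemma spread_size_natr (k : R) n : 0 < k -> k < 1 ->
  (spread_size k n)%:R = n%:R - (Num.truncn (3 / 4 * k * n%:R))%:R :> R.
Proof.
move=> k0 k1; rewrite /spread_size natrB// -(ler_nat R).
apply: le_trans (truncn_spread n k0).1 _.
by rewrite ler_piMl//; lra.
Qed.

Lemma good_matrix_spread (k : R) m n (A : 'I_m * 'I_n -> R) (z : 'I_n -> R) :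
  0 < k -> k < 1 -> (0 < m)%N -> (0 < n)%N ->
  good_matrix (spread_scale k) (spread_size k n) A ->
  in_kernel A z -> \sum_j z j ^+ 2 = n%:R ->
  (#|[set j | `|z j| <= spread_radius k]%SET|)%:R < k * n%:R.
Proof.
move=> k0 k1 m0 n0 gA kz zn.
have k8 : 0 < k / 8 by rewrite divr_gt0.
have k81 : k / 8 < 1 by lra.
have [h _] := good_matrix_kernel m0 n0 (spread_scale_gt0 k) (spread_scale_le k0) k8 k81 gA kz zn.
move: h; rewrite -/(spread_radius k) spread_size_natr//.
set J := [set j | _]%SET.
rewrite natrB; last by rewrite -[X in (_ <= X)%N]card_ord max_card.
have [h1 _] := truncn_spread n k0.
move: h1; set T := (Num.truncn (3 / 4 * k * n%:R))%:R; set X := (#|J|)%:R.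
rewrite (_ : 2 * (k / 8) * n%:R = 1 / 4 * k * n%:R); last by field.
move=> h1 h2.
rewrite (_ : k * n%:R = 1 / 4 * k * n%:R + 3 / 4 * k * n%:R); last by field.
lra.
Qed.

Lemma spread_prob (k : R) m n d (T : measurableType d)
    (P : probability T R) (G : 'I_m * 'I_n -> T -> R) :
  gaussian_family P G -> 0 < k -> k < 1 -> (0 < n)%N -> 4 / k <= n%:R ->
  (1 - k / 4) * n%:R <= m%:R ->
  (P [set w | ~ good_matrix (spread_scale k) (spread_size k n) (G ^~ w)] <=
   (expR (- (n%:R / 2)) + expR (- n%:R))%:E)%E.
Proof.
move=> gG k0 k1 n0 kn mn.
apply: good_matrix_prob => //; rewrite ?leq_subr//; first by rewrite divr_gt0.
- by lra.
- rewrite spread_size_natr//; have [_ h] := truncn_spread n k0.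
  (* Up to the rounding error 1, s + (k/4) n is (1 - k/2) n, which stays below (1 - k/4) n as soon
     as k n >= 4. *)
  have : 4 <= k * n%:R by rewrite mulrC -ler_pdivrMr.
  move: h; set T' := (Num.truncn (3 / 4 * k * n%:R))%:R.
  rewrite (_ : 3 / 4 * k * n%:R = 3 / 4 * (k * n%:R)); last by ring.
  move: mn; rewrite mulrBl mul1r (_ : k / 4 * n%:R = k * n%:R / 4); last by ring.
  by set q := k * n%:R; lra.
Qed.

(** With s = n every support is allowed, and the conclusion s < n of [good_matrix_kernel] excludes
    kernel vectors of squared norm n, hence by scaling all nonzero ones. *)
Lemma trivial_kernel_prob (eps : R) : 0 < eps -> eps <= 1 ->
  forall m n d (T : measurableType d)
    (P : probability T R) (G : 'I_m * 'I_n -> T -> R),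
    gaussian_family P G -> (0 < n)%N -> (1 + eps) * n%:R <= m%:R ->
    exists E : set T, [/\ measurable E,
      (P E <= (expR (- (n%:R / 2)) + expR (- n%:R))%:E)%E &
      forall w, ~ E w -> forall z, in_kernel (G ^~ w) z -> \sum_j z j ^+ 2 <> n%:R].
Proof.
move=> eps0 eps1 m n d T P G gG n0 mn.
exists [set w | ~ good_matrix (expR (- (9 + 14 / eps))) n (G ^~ w)].
have n0' : 0 < n%:R :> R by rewrite ltr0n.
split.
- exact: measurable_not_good_matrix gG.
- by apply: good_matrix_prob => //; lra.
move=> w /= /contrapT gw z kz zn.
have m0 : (0 < m)%N.
  rewrite -(ltr0n R); apply: lt_le_trans mn; rewrite mulr_gt0//; lra.
have e2 : expR (- (9 + 14 / eps)) <= 2^-1.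
  apply: le_trans expRN1_le_half; rewrite ler_expR.
  have : 0 <= 14 / eps by rewrite divr_ge0// ltW.
  lra.
have h2 : (2^-1 : R) < 1 by lra.
have h0 : (0 : R) < 2^-1 by lra.
have [_] := good_matrix_kernel m0 n0 (expR_gt0 _) e2 h0 h2 gw kz zn.
by rewrite ltnn.
Qed.

End SpreadConstants.

(** * Probability that a fixed colouring is bad *)

Section BadProbability.
Context {R : realType}.
Variables (H : option bool -> R -> R) (th rho' kap nu t a b : R).

Definition colour_prob (c : option bool) : R := if c is Some _ then th / 2 else 1 - th.

Hypothesis th01 : 0 <= th <= 1.
Hypothesis HSN : forall b x, H (Some b) (- x) = H (Some (~~ b)) x.
Hypothesis HSle : forall b x, H (Some b) x <= H None x.
Hypothesis Hc : forall i, continuous (H i).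
Hypothesis HL : forall c x y, `|H c x - H c y| <= nu / 2 * (1 + ((x - y) / t) ^+ 2).
Hypothesis H2 : forall c x, H c x ^+ 2 <= 1 + x ^+ 2.
Hypothesis Hmb : forall x, - b <= \sum_c colour_prob c * H c x.
Hypothesis Hma : forall x, spread_radius kap < `|x| ->
  a <= \sum_c colour_prob c * H c x.
Hypotheses (kap0 : 0 < kap) (kap1 : kap < 1) (t0 : 0 < t) (t1 : t <= 1)
  (nu0 : 0 < nu) (a0 : 0 <= a) (b0 : 0 <= b) (hnu : 4 * nu <= a - (a + b) * kap).
Hypothesis rho_th : rho' < th.

Lemma big_option_bool (F : option bool -> R) :
  \sum_c F c = F None + F (Some true) + F (Some false).
Proof.
rewrite (bigD1 None)//= (bigD1 (Some true))//= (bigD1 (Some false))//= big1 ?addr0 ?addrA//.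
by case=> [[]|].
Qed.

Lemma colour_prob_ge0 c : 0 <= colour_prob c.
Proof. by have /andP[h1 h2] := th01; case: c => [?|]; rewrite /colour_prob; lra. Qed.

Lemma sum_colour_prob : \sum_c colour_prob c = 1.
Proof. by rewrite big_option_bool /colour_prob; lra. Qed.

(** Chernoff with l = (th - rho')/8, which minimises -(th - rho') l + 4 l^2. *)
Lemma few_coloured_weight n :
  \sum_(c : {ffun 'I_n -> option bool} | (#|coloured c|)%:R <= rho' * n%:R)
    colour_weight colour_prob c <= expR (- (n%:R * ((th - rho') ^+ 2 / 16))).
Proof.
pose F (i : 'I_n) (c : option bool) : R := if c is Some _ then 1 else 0.
pose l := (th - rho') / 8.
have l0 : 0 <= l by rewrite divr_ge0// subr_ge0 ltW.
have Fb (i : 'I_n) c : `|F i c| <= (fun=> 1) i.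
  by case: c => [?|] /=; rewrite ?normr1 ?normr0.
have := colour_chernoff (rho' * n%:R) colour_prob_ge0 sum_colour_prob Fb l0.
have FE (c : {ffun 'I_n -> option bool}) : \sum_i F i (c i) = (#|coloured c|)%:R.
  rewrite /F -sum1_card natr_sum [RHS]big_mkcond/=; apply: eq_bigr => i _.
  by rewrite inE; case: (c i).
under eq_bigl do rewrite FE.
move=> /le_trans; apply; rewrite ler_expR.
have -> : \sum_(i < n) \sum_c colour_prob c * F i c = n%:R * th.
  rewrite (eq_bigr (fun=> th)); last first.
    by move=> i _; rewrite big_option_bool /F /colour_prob; lra.
  by rewrite sumr_const card_ord mulr_natl.
have -> : \sum_(i < n) 1 ^+ 2 = n%:R :> R.
  by under eq_bigr do rewrite expr1n; rewrite sumr_const card_ord.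
rewrite le_eqVlt; apply/orP; left; by apply/eqP; rewrite /l; field.
Qed.

Lemma bad_colouring_prob :
  exists k1 c : R, exists N : nat, [/\ 0 < k1, k1 < 1 & 0 < c] /\
  forall m n (c0 : {ffun 'I_n -> option bool}) d (T : measurableType d)
    (P : probability T R) (G : 'I_m * 'I_n -> T -> R),
    gaussian_family P G -> (N <= n)%N -> (1 - k1) * n%:R <= m%:R ->
    (#|coloured c0|)%:R <= rho' * n%:R ->
    (P [set w | bad_colouring H (G ^~ w) c0] <= (expR (- (c * n%:R)))%:E)%E.
Proof.
pose B := t^-1 + 2.
have B0 : 0 < B by rewrite addr_gt0// invr_gt0.
(* The net has about exp(ka B n) points; ka B <= nu^2/40 keeps this below half of the deviation
   exponent nu^2/20. *)
pose ka := Num.min kap (Num.min (nu ^+ 2 / 40 / B) (1 / 2)).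
have nu2 : 0 < nu ^+ 2 by rewrite exprn_gt0.
have ka0 : 0 < ka.
  by rewrite !lt_min kap0 divr_gt0 ?divr_gt0//=; lra.
have kale : ka <= kap by rewrite ge_min lexx.
have kaB : ka * B <= nu ^+ 2 / 40.
  by rewrite -ler_pdivlMr// !ge_min lexx orbT.
have ka1 : ka < 1.
  by apply: le_lt_trans kale _.
pose g := (th - rho') ^+ 2 / 16.
have g0 : 0 < g by rewrite divr_gt0// exprn_gt0// subr_gt0.
(* The rate is halved so that the final factor 10 is absorbed: 10 exp(-2 c n) <= exp(- c n) once c n
   >= 9. *)
pose c := Num.min (nu ^+ 2 / 80) (1 / 2) / 2.
have mc : 0 < Num.min (nu ^+ 2 / 80) (1 / 2) by rewrite lt_min divr_gt0//=; lra.
have c0 : 0 < c by rewrite divr_gt0.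
(* In order: [spread_prob] applies at level [ka], the integer rounding of the dimension bound is
   negligible, colourings with too few coloured points weigh at most 1/2, and the final factor 10 is
   absorbed. *)
pose M := Num.max (4 / ka) (Num.max (80 * B / nu ^+ 2) (Num.max (1 / g) (9 / c))).
exists (ka / 4), c, (Num.truncn M).+1; split.
  by split => //; [rewrite divr_gt0|lra].
move=> m n c1 d T P G gG nN mn cn.
have nM : M <= n%:R.
  apply: ltW; apply: lt_le_trans (_ : (Num.truncn M).+1%:R <= _); last by rewrite ler_nat.
  have : 0 <= M by rewrite le_max divr_ge0// ltW.
  by move=> /truncn_itv /andP[].
have n0 : (0 < n)%N by apply: leq_trans nN.
have n0' : 0 < n%:R :> R by rewrite ltr0n.
have [n1 n2 n3 n4] : [/\ 4 / ka <= n%:R, 80 * B / nu ^+ 2 <= n%:R, 1 / g <= n%:R & 9 / c <= n%:R].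
  by move: nM; rewrite !ge_max => /and4P[].
have m0 : (0 < m)%N.
  rewrite -(ltr0n R); apply: lt_le_trans mn; rewrite mulr_gt0//; lra.
have kn : 4 / kap <= n%:R.
  by apply: le_trans n1; rewrite ler_wpM2l// lef_pV2.
have mkap : (1 - kap / 4) * n%:R <= m%:R.
  by apply: le_trans mn; rewrite ler_wpM2r//; lra.
have mG := gaussian_family_measurable gG.
have mgood k : measurable [set w | ~ good_matrix (spread_scale k) (spread_size k n) (G ^~ w)].
  exact: measurable_not_good_matrix gG.
pose N1 := [set w | ~ good_matrix (spread_scale kap) (spread_size kap n) (G ^~ w)].
pose N2 := [set w | ~ good_matrix (spread_scale ka) (spread_size ka n) (G ^~ w)].
have mE (cc : {ffun 'I_n -> option bool}) : measurable [set w | bad_colouring H (G ^~ w) cc].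
  have := mG measurableT _ (@measurable_bad_colouring _ _ H m n cc Hc).
  by rewrite setTI.
(* The extra 1 from rounding up costs [B] in the exponent, at most nu^2 n/80; what remains is 1/20 -
   1/40 - 1/80 = 1/80. *)
pose q := (Num.truncn (ka * n%:R)).+1.
have kan : 0 <= ka * n%:R by rewrite mulr_ge0// ltW.
have [q1 q2] := andP (truncn_itv kan).
have qn : (q <= n)%N.
  rewrite /q -(ltr_nat R); apply: le_lt_trans q1 _.
  by rewrite gtr_pMl.
have qle : q%:R <= ka * n%:R + 1 by rewrite /q -addn1 natrD lerD2r.
pose be := expR (- (n%:R * (nu ^+ 2 / 80))).
have avg := averaged_prob_le (W := colour_weight colour_prob)
  (E := fun cc w => bad_colouring H (G ^~ w) cc) (N := N1 `|` N2) (b := be) P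
  (fun cc => colour_weight_ge0 cc colour_prob_ge0)
  (sum_colour_weight _ sum_colour_prob) (expR_ge0 _) mE (measurableU _ _ (mgood kap) (mgood ka)).
have {}avg : (\sum_cc (colour_weight colour_prob cc)%:E *
    P [set w | bad_colouring H (G ^~ w) cc] <= be%:E + P (N1 `|` N2))%E.
  apply: avg => w; rewrite -[~ _]/((~` (N1 `|` N2)) w) setCU => -[/= /contrapT g1 /contrapT g2].
  have sp1 z : in_kernel (G ^~ w) z -> \sum_j z j ^+ 2 = n%:R ->
      (#|[set j | `|z j| <= spread_radius kap]%SET|)%:R <= kap * n%:R.
    by move=> kz zn; apply: ltW; exact: good_matrix_spread g1 kz zn.
  have sp2 z : in_kernel (G ^~ w) z -> \sum_j z j ^+ 2 = n%:R ->
      (#|[set j | z j == 0%R]%SET| < q)%N.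
    move=> kz zn; have h := good_matrix_spread ka0 ka1 m0 n0 g2 kz zn.
    rewrite -(ltr_nat R); apply: lt_trans q2; apply: le_lt_trans h.
    rewrite ler_nat; apply: subset_leq_card; apply/fintype.subsetP => j; rewrite !inE.
    by move=> /eqP ->; rewrite normr0 ltW// spread_radius_gt0.
  have := bad_colouring_weight n0 qn t0 t1 nu0 a0 b0 colour_prob_ge0
    sum_colour_prob HL H2 Hmb Hma hnu sp2 sp1.
  move=> /le_trans; apply; rewrite /be ler_expR -/B.
  have h1 : q%:R * B <= (ka * n%:R + 1) * B by rewrite ler_wpM2r// ltW.
  have h2 : ka * B * n%:R <= nu ^+ 2 / 40 * n%:R by rewrite ler_wpM2r.
  have h3 : 80 * B <= nu ^+ 2 * n%:R by rewrite [leRHS]mulrC -ler_pdivrMr.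
  move: h1; rewrite mulrDl mul1r mulrAC => h1.
  move: h1 h2 h3; rewrite (_ : nu ^+ 2 / 40 * n%:R = nu ^+ 2 * n%:R / 40); last by ring.
  rewrite (_ : n%:R * (nu ^+ 2 / 20) = nu ^+ 2 * n%:R / 20); last by ring.
  rewrite (_ : n%:R * (nu ^+ 2 / 80) = nu ^+ 2 * n%:R / 80); last by ring.
  by set x := nu ^+ 2 * n%:R; set y := q%:R * B; lra.
have fin (E : set T) : measurable E -> exists r : R, [/\ P E = r%:E, 0 <= r & r <= 1].
  move=> mE'; exists (fine (P E)).
  have f := fin_num_measure P E mE'; split; first by rewrite fineK.
    by apply: fine_ge0.
  by rewrite -lee_fin fineK// probability_le1.
have [p0 [pE p00 p01]] := fin _ (mE c1).
have pN : (P (N1 `|` N2) <= (2 * (expR (- (n%:R / 2)) + expR (- n%:R)))%:E)%E.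
  apply: le_trans (measureU2 _ (mgood kap) (mgood ka)) _.
  rewrite mulr_natl mulr2n EFinD; apply: leeD; exact: spread_prob.
(* At least half of the weight lies on colourings with more than rho' n coloured coordinates. Each
   of these fails with probability at least [p0] by monotonicity, so [p0 / 2] is below the
   average. *)
have half : p0 / 2 <= \sum_(cc : {ffun 'I_n -> option bool}) colour_weight colour_prob cc *
    (if (#|coloured cc|)%:R <= rho' * n%:R then 0 else p0).
  have -> : \sum_(cc : {ffun 'I_n -> option bool}) colour_weight colour_prob cc *
    (if (#|coloured cc|)%:R <= rho' * n%:R then 0 else p0) =
    p0 * (1 - \sum_(cc : {ffun 'I_n -> option bool} | (#|coloured cc|)%:R <= rho' * n%:R)
       colour_weight colour_prob cc).
    rewrite -(sum_colour_weight 'I_n sum_colour_prob) [X in _ - X]big_mkcond/=.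
    rewrite -sumrB mulr_sumr; apply: eq_bigr => cc _.
    by case: ifP => _; ring.
  rewrite ler_wpM2l//.
  have := few_coloured_weight n; rewrite -/g.
  have : expR (- (n%:R * g)) <= 2^-1.
    apply: le_trans expRN1_le_half; rewrite ler_expR lerN2.
    by rewrite -ler_pdivrMr.
  by lra.
have avg2 : p0 / 2 <= be + 2 * (expR (- (n%:R / 2)) + expR (- n%:R)).
  rewrite -lee_fin; apply: (@le_trans _ _ (be%:E + P (N1 `|` N2))%E); last first.
    by rewrite EFinD leeD2l.
  apply: le_trans avg; apply: (@le_trans _ _ (\sum_(cc : {ffun 'I_n -> option bool})
     (colour_weight colour_prob cc)%:E *
     (if ((#|coloured cc|)%:R <= rho' * n%:R)%R then 0 else p0)%:E)%E).
    by under eq_bigr do rewrite -EFinM; rewrite sumEFin lee_fin.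
  apply: lee_sum => cc _; apply: lee_wpmul2l.
    by rewrite lee_fin colour_weight_ge0// => ?; exact: colour_prob_ge0.
  case: ifPn => [_|]; first by rewrite measure_ge0.
  rewrite -ltNge => hcc; rewrite -pE; apply: bad_colouring_prob_mono => //.
  by rewrite -(ler_nat R); apply: le_trans cn (ltW hcc).
rewrite pE lee_fin.
have e1 : expR (- n%:R) <= expR (- (2 * c * n%:R)).
  rewrite ler_expR lerN2 ler_piMl// /c mulrC divfK//.
  by rewrite ge_min; apply/orP; right; lra.
have e2 : expR (- (n%:R / 2)) <= expR (- (2 * c * n%:R)).
  rewrite ler_expR lerN2 [leRHS]mulrC ler_wpM2r// /c mulrC divfK//.
  by rewrite ge_min; apply/orP; right; lra.
have e3 : be <= expR (- (2 * c * n%:R)).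
  rewrite ler_expR lerN2 [leRHS]mulrC ler_wpM2r// /c mulrC divfK//.
  by rewrite ge_min lexx.
have e4 : 10 * expR (- (2 * c * n%:R)) <= expR (- (c * n%:R)).
  rewrite (_ : - (2 * c * n%:R) = - (c * n%:R) + - (c * n%:R)); last by ring.
  rewrite expRD mulrA ler_piMl ?expR_ge0//.
  rewrite expRN ler_pdivrMr ?expR_gt0// mul1r.
  apply: le_trans (expR_ge1Dx _).
  by move: n4; rewrite ler_pdivrMr// [n%:R * c]mulrC; lra.
by lra.
Qed.

End BadProbability.

(** * Recovery *)

Definition recovers_fixed_sign_pattern (R : realType) (p rho : R) : Prop :=
  exists c7 c8 : R, [/\ 0 < c7, c7 < 1 & 0 < c8] /\
  exists N : nat, forall m n : nat, (N <= n)%N ->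
    c7 < m%:R / n%:R ->
    forall (T : {set 'I_n}) (sigma : 'I_n -> R),
      #|T|%:R <= rho * m%:R ->
      (forall i, i \in T -> sigma i = 1 \/ sigma i = -1) ->
    forall (d : measure_display) (Omega : measurableType d)
           (P : probability Omega R) (G : 'I_m * 'I_n -> Omega -> R),
      mutually_independent P G ->
      (forall k, std_gaussian P (G k)) ->
      exists E : set Omega, measurable E /\
        ((1 - expR (- (c8 * n%:R)))%:E <= P E)%E /\
        forall w, E w ->
          forall x : 'cV[R]_n,
            (forall i, x i 0 != 0 <-> i \in T) ->
            (forall i, i \in T -> Num.sg (x i 0) = sigma i) ->
            unique_lp_minimizer p (gauss_matrix G w) x.

Section Recovery.
Context {R : realType}.
Variables (H : option bool -> R -> R) (f g : R -> R).
(** The profile minorises the increments of the objective [f] at coordinates that are zero, positive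
    or negative. The factor [g s] accounts for rescaling the kernel vector: s^p for powers, 1 for
    the count. *)
Hypothesis g0 : forall s, 0 < s -> 0 < g s.
Hypothesis HNf : forall s z, 0 < s -> H None (s * z) <= g s * (f z - f 0).
Hypothesis Hpf : forall s x z, 0 < s -> 0 < x ->
  H (Some true) (s * z) <= g s * (f (x + z) - f x).
Hypothesis Hnf : forall s x z, 0 < s -> x < 0 ->
  H (Some false) (s * z) <= g s * (f (x + z) - f x).

Lemma kernel_difference m n (A : 'M[R]_(m, n)) (x v : 'cV[R]_n) :
  (0 < n)%N -> A *m v = A *m x -> v <> x ->
  exists2 s : R, 0 < s &
    in_kernel (fun k => A k.1 k.2) (fun j => s * (v j 0 - x j 0)) /\
    \sum_j (s * (v j 0 - x j 0)) ^+ 2 = n%:R.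
Proof.
move=> n0 Avx vx.
have n0' : 0 < n%:R :> R by rewrite ltr0n.
pose z j := v j 0 - x j 0.
have kz : in_kernel (fun k => A k.1 k.2) z.
  move=> i; rewrite /= (eq_bigr (fun j => A i j * v j 0 - A i j * x j 0)); last first.
    by move=> j _; rewrite mulrBr.
  rewrite sumrB; apply/eqP; rewrite subr_eq0; apply/eqP.
  by have /matrixP/(_ i 0) := Avx; rewrite !mxE.
have zz : 0 < \sum_j z j ^+ 2.
  rewrite lt_neqAle sumr_ge0 ?andbT; last by move=> j _; exact: sqr_ge0.
  rewrite eq_sym psumr_eq0; last by move=> j _; exact: sqr_ge0.
  apply/negP => /allP h; apply: vx; apply/colP => j.
  have := h j (mem_index_enum j); rewrite sqrf_eq0 => /eqP.
  by rewrite /z => /eqP; rewrite subr_eq0 => /eqP.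
exists (Num.sqrt (n%:R / \sum_j z j ^+ 2)); first by rewrite sqrtr_gt0 divr_gt0.
split; first exact: in_kernelZ.
set s := Num.sqrt _.
rewrite (eq_bigr (fun j => s ^+ 2 * z j ^+ 2)); last by move=> j _; rewrite exprMn.
rewrite -mulr_sumr sqr_sqrtr; last by rewrite divr_ge0// ltW.
by rewrite divfK// gt_eqF.
Qed.

Definition support_colours n (T : {set 'I_n}) (sigma : 'I_n -> R) :
    {ffun 'I_n -> option bool} :=
  [ffun j => if j \in T then Some (sigma j == 1) else None].

(** The rescaled difference v - x is a kernel vector whose profile sum is positive because the
    colouring is not bad; this sum is at most a positive multiple of the increase of the
    objective. *)
Lemma recovery_of_not_bad m n (A : 'M[R]_(m, n)) (T : {set 'I_n}) (sigma : 'I_n -> R)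
    (x v : 'cV[R]_n) :
  (0 < n)%N -> (forall i, i \in T -> sigma i = 1 \/ sigma i = -1) ->
  ~ bad_colouring H (fun k => A k.1 k.2) (support_colours T sigma) ->
  (forall i, x i 0 != 0 <-> i \in T) ->
  (forall i, i \in T -> Num.sg (x i 0) = sigma i) ->
  A *m v = A *m x -> v <> x ->
  \sum_j f (x j 0) < \sum_j f (v j 0).
Proof.
move=> n0 sT nbad suppx sgx Avx vx.
have [s s0 [kz zn]] := kernel_difference n0 Avx vx.
have pos : 0 < \sum_j H (support_colours T sigma j) (s * (v j 0 - x j 0)).
  rewrite ltNge; apply/negP => hH; apply: nbad.
  by exists (fun j => s * (v j 0 - x j 0)); split.
rewrite -subr_gt0 -sumrB -(pmulr_rgt0 _ (g0 s0)) mulr_sumr.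
apply: lt_le_trans pos _; apply: ler_sum => j _; rewrite ffunE.
set z := v j 0 - x j 0.
have vE : v j 0 = x j 0 + z by rewrite /z addrC subrK.
case: ifPn => jT; last first.
  have xj : x j 0 = 0.
    by apply/eqP/negPn/negP => /suppx; apply/negP.
  by rewrite vE xj add0r; exact: HNf.
have := sgx j jT; rewrite vE; case: (sT j jT) => ->.
  by rewrite eqxx => /eqP; rewrite sgr_cp0 => xj; exact: Hpf.
have -> : (-1 == 1 :> R) = false by apply/negbTE; rewrite lt_eqF//; lra.
by move=> /eqP; rewrite sgr_cp0 => xj; exact: Hnf.
Qed.

Variables (th rho rho' rho1 eps kap nu t a b p : R).
Hypothesis fE : forall n (v : 'cV[R]_n), lp_pow p v = \sum_j f (v j 0).
Hypothesis th01 : 0 <= th <= 1.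
Hypothesis HSN : forall b x, H (Some b) (- x) = H (Some (~~ b)) x.
Hypothesis HSle : forall b x, H (Some b) x <= H None x.
Hypothesis Hc : forall i, continuous (H i).
Hypothesis HL : forall c x y, `|H c x - H c y| <= nu / 2 * (1 + ((x - y) / t) ^+ 2).
Hypothesis H2 : forall c x, H c x ^+ 2 <= 1 + x ^+ 2.
Hypothesis Hmb : forall x, - b <= \sum_c colour_prob th c * H c x.
Hypothesis Hma : forall x, spread_radius kap < `|x| ->
  a <= \sum_c colour_prob th c * H c x.
Hypotheses (kap0 : 0 < kap) (kap1 : kap < 1) (t0 : 0 < t) (t1 : t <= 1)
  (nu0 : 0 < nu) (a0 : 0 <= a) (b0 : 0 <= b) (hnu : 4 * nu <= a - (a + b) * kap).
Hypothesis rho_th : rho' < th.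
Hypotheses (eps0 : 0 < eps) (eps1 : eps <= 1) (rho1_ge0 : 0 <= rho1)
  (rho_rho1 : rho <= rho1) (rho1_rho' : rho1 * (1 + eps) <= rho').

Lemma sparse_recovery : recovers_fixed_sign_pattern p rho.
Proof.
have [k1 [c [N [[k0 k11 c0] main]]]] := bad_colouring_prob th01 HSN HSle Hc HL H2
  Hmb Hma kap0 kap1 t0 t1 nu0 a0 b0 hnu rho_th.
(* The 1/4 serves tall matrices: 2 exp(-n/2) <= exp(-n/4) for n >= 4, which is also why N is at
   least 4. *)
exists (1 - k1), (Num.min c (1 / 4)); split.
  by split; rewrite ?lt_min ?c0/=; lra.
exists (maxn N 4) => m n; rewrite geq_max => /andP[nN n4] hmn T sigma Trho sT d Omega P G indG stdG.
have gG : gaussian_family P G by [].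
have n0 : (0 < n)%N by apply: leq_trans n4.
have n0' : 0 < n%:R :> R by rewrite ltr0n.
have n4' : 4 <= n%:R :> R by rewrite (ler_nat R 4).
have mn : (1 - k1) * n%:R <= m%:R by rewrite -ler_pdivlMr// ltW.
have mx_kernel w z : in_kernel (G ^~ w) z <->
    in_kernel (fun k => gauss_matrix G w k.1 k.2) z.
  have E i : \sum_j gauss_matrix G w i j * z j = \sum_j G (i, j) w * z j.
    by apply: eq_bigr => j _; rewrite mxE.
  by split=> h i; have := h i; rewrite /= E.
have complement (B : set Omega) : measurable B ->
    (P B <= (expR (- (Num.min c (1 / 4) * n%:R)))%:E)%E ->
    ((1 - expR (- (Num.min c (1 / 4) * n%:R)))%:E <= P (~` B))%E.
  move=> mB PB; rewrite probability_setC// EFinB.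
  by apply: leeB.
(* The bound rho m on the support turns into rho' n only when m <= (1 + eps) n; for larger m no v
   other than x is feasible. *)
have [large|small] := leP ((1 + eps) * n%:R) m%:R.
  have [E [mE PE hE]] := trivial_kernel_prob eps0 eps1 gG n0 large.
  exists (~` E); split; first exact: measurableC.
  split.
    apply: complement => //; apply: le_trans PE _; rewrite lee_fin.
    have h1 : expR (- n%:R) <= expR (- (n%:R / 2)) :> R by rewrite ler_expR; lra.
    have h2 : 2 * expR (- (n%:R / 2)) <= expR (- (n%:R / 4)) :> R.
      rewrite (_ : - (n%:R / 2) = - (n%:R / 4) + - (n%:R / 4)); last by field.
      rewrite expRD mulrA ler_piMl ?expR_ge0// expRN ler_pdivrMr ?expR_gt0// mul1r.
      by apply: le_trans (expR_ge1Dx _); lra.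
    have h3 : expR (- (n%:R / 4)) <= expR (- (Num.min c (1 / 4) * n%:R)).
      rewrite ler_expR lerN2 [leRHS]mulrC ler_wpM2r// ge_min.
      by apply/orP; right; lra.
    by lra.
  move=> w Ew x _ _ v Avx vx; exfalso.
  have [s _ [/mx_kernel kz zn]] := kernel_difference n0 Avx vx.
  exact: (hE w Ew _ kz zn).
have TB : (#|coloured (support_colours T sigma)|)%:R <= rho' * n%:R.
  have -> : coloured (support_colours T sigma) = T.
    by apply/setP => j; rewrite !inE ffunE; case: (j \in T).
  apply: le_trans Trho _; apply: (@le_trans _ _ (rho1 * m%:R)).
    by rewrite ler_wpM2r.
  apply: (@le_trans _ _ (rho1 * ((1 + eps) * n%:R))).
    by rewrite ler_wpM2l// ltW.
  by rewrite mulrA ler_wpM2r.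
have mG := gaussian_family_measurable gG.
pose B := [set w | bad_colouring H (G ^~ w) (support_colours T sigma)].
have mB : measurable B.
  have := mG measurableT _ (@measurable_bad_colouring _ _ H m n (support_colours T sigma) Hc).
  by rewrite setTI.
exists (~` B); split; first exact: measurableC.
split.
  apply: complement => //; apply: le_trans (main _ _ _ _ _ P G gG nN mn TB) _.
  by rewrite lee_fin ler_expR lerN2 ler_wpM2r// ge_min lexx.
move=> w nB x suppx sgx v Avx vx; rewrite !fE.
apply: (recovery_of_not_bad n0 sT _ suppx sgx Avx vx).
move=> [z [kz zn hz]]; apply: nB; exists z; split => //.
by apply/mx_kernel.
Qed.

End Recovery.

(** * The two profiles *)

Section PowerProfile.
Context {R : realType}.
Variable p : R.
Hypotheses (p0 : 0 < p) (p1 : p <= 1).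

Definition abs_pow (x : R) : R := `|x| `^ p.

Lemma abs_pow_ge0 x : 0 <= abs_pow x. Proof. exact: powR_ge0. Qed.

Lemma abs_pow0 : abs_pow 0 = 0.
Proof. by rewrite /abs_pow normr0 powR0// gt_eqF. Qed.

Lemma abs_powN x : abs_pow (- x) = abs_pow x.
Proof. by rewrite /abs_pow normrN. Qed.

Lemma abs_powM x y : abs_pow (x * y) = abs_pow x * abs_pow y.
Proof. by rewrite /abs_pow normrM powRM. Qed.

Lemma abs_pow_le x y : `|x| <= `|y| -> abs_pow x <= abs_pow y.
Proof.
by move=> xy; apply: ge0_ler_powR; rewrite ?nnegrE ?(ltW p0).
Qed.

(** A fraction u/s in (0, 1] is at most (u/s)^p for p <= 1; this is applied to the shares of |x| and
    |y| in s = |x| + |y|. *)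
Lemma abs_powD x y : abs_pow (x + y) <= abs_pow x + abs_pow y.
Proof.
have [s0|s0] := eqVneq (`|x| + `|y|) 0.
  have x0 : x = 0 by apply/eqP; rewrite -normr_eq0; apply/eqP;
    have := normr_ge0 x; have := normr_ge0 y; lra.
  by rewrite x0 add0r lerDr abs_pow_ge0.
have sp : 0 < `|x| + `|y| by rewrite lt_neqAle eq_sym s0 addr_ge0.
apply: (@le_trans _ _ (abs_pow (`|x| + `|y|))).
  by apply: abs_pow_le; rewrite [leRHS]ger0_norm ?ler_normD ?addr_ge0.
have part u : 0 <= u <= `|x| + `|y| -> u / (`|x| + `|y|) * abs_pow (`|x| + `|y|) <= abs_pow u.
  move=> /andP[u0 us]; have [->|un] := eqVneq u 0.
    by rewrite mul0r mul0r abs_pow_ge0.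
  rewrite -[X in _ <= abs_pow X](divfK s0 u) abs_powM ler_wpM2r ?abs_pow_ge0//.
  rewrite /abs_pow [`|u / _|]ger0_norm; last by rewrite divr_ge0 // ltW.
  apply: ger1_powR => //; apply/andP; split.
    by rewrite divr_gt0// lt_neqAle eq_sym un.
  by rewrite ler_pdivrMr// mul1r.
have hx := part `|x|; have hy := part `|y|.
have -> : abs_pow x = abs_pow `|x| by rewrite /abs_pow normr_id.
have -> : abs_pow y = abs_pow `|y| by rewrite /abs_pow normr_id.
apply: le_trans (lerD (hx _) (hy _)).
- by rewrite -mulrDl -mulrDl divff// mul1r.
- by rewrite normr_ge0 lerDl normr_ge0.
- by rewrite normr_ge0 lerDr normr_ge0.
Qed.

Lemma abs_pow_dist x y : `|abs_pow x - abs_pow y| <= abs_pow (x - y).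
Proof.
have h1 := abs_powD (x - y) y; have h2 := abs_powD (y - x) x.
rewrite !subrK in h1 h2; rewrite -opprB abs_powN in h2.
by rewrite ler_norml; apply/andP; split; lra.
Qed.

(** For p <= 1, |y|^p <= 1 + y^2. This converts the Hölder modulus of the profile into the quadratic
    one that sums well over a net. *)
Lemma abs_pow_scale (t x : R) : 0 < t -> abs_pow x <= t `^ p * (1 + (x / t) ^+ 2).
Proof.
move=> t0.
have -> : abs_pow x = t `^ p * abs_pow (x / t).
  rewrite abs_powM mulrC -mulrA /abs_pow normfV (gtr0_norm t0).
  by rewrite -powRM ?invr_ge0 ?(ltW t0)// mulVf ?gt_eqF// powR1 mulr1.
rewrite ler_wpM2l ?powR_ge0//; set y := x / t.
have [y1|y1] := leP `|y| 1.
  apply: (@le_trans _ _ 1); last by rewrite lerDl sqr_ge0.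
  apply: le_trans (abs_pow_le (y := 1) _) _; first by rewrite normr1.
  by rewrite /abs_pow normr1 powR1.
apply: (@le_trans _ _ `|y|).
  by apply: ler1_powR => //; exact: ltW.
rewrite -real_normK ?num_real//.
apply: (@le_trans _ _ (`|y| ^+ 2)); last by rewrite lerDr.
by rewrite expr2 ler_peMl// ltW.
Qed.

Lemma abs_pow_sqr x : abs_pow x ^+ 2 <= 1 + x ^+ 2.
Proof.
have h0 := abs_pow_ge0 x.
have [x1|x1] := leP `|x| 1.
  apply: (@le_trans _ _ 1); last by rewrite lerDl sqr_ge0.
  apply: exprn_ile1 => //.
  apply: le_trans (abs_pow_le (y := 1) _) _; first by rewrite normr1.
  by rewrite /abs_pow normr1 powR1.
rewrite -[x ^+ 2]real_normK ?num_real//.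
apply: (@le_trans _ _ (`|x| ^+ 2)); last by rewrite lerDr.
apply: lerXn2r; rewrite ?nnegrE//.
by apply: ler1_powR => //; exact: ltW.
Qed.

Lemma continuous_of_abs_pow_dist (h : R -> R) (K : R) : 0 < K ->
  (forall x y, `|h x - h y| <= K * abs_pow (x - y)) -> continuous h.
Proof.
move=> K0 hh x; apply/cvgrPdist_lt => e e0; near=> y.
apply: le_lt_trans (hh x y) _.
rewrite -ltr_pdivlMl// mulrC.
have -> : e / K = (e / K) `^ p^-1 `^ p.
  by rewrite -powRrM mulVf ?gt_eqF// powRr1// divr_ge0// ltW.
apply: gt0_ltr_powR => //; rewrite ?nnegrE ?powR_ge0//.
near: y; apply: cvgr_dist_lt => //.
by rewrite powR_gt0// divr_gt0.
Unshelve. all: by end_near. Qed.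

(** On the support only the move against the sign costs: subadditivity bounds the loss by |z|^p, and
    moving along the sign cannot decrease |x|^p. *)
Definition power_profile (c : option bool) (x : R) : R :=
  if c is Some b then - abs_pow (Num.min (if b then x else - x) 0) else abs_pow x.

Lemma min0_dist (x y : R) : `|Num.min x 0 - Num.min y 0| <= `|x - y|.
Proof.
have h1 := ler_norm (x - y); have h2 := ler_norm (- (x - y)); rewrite normrN in h2.
by rewrite /Num.min; case: ltP => hx; case: ltP => hy; rewrite ler_norml; lra.
Qed.

Lemma min0_norm (x : R) : `|Num.min x 0| <= `|x|.
Proof. by have := min0_dist x 0; rewrite minxx !subr0. Qed.

Lemma power_profile_dist c x y :
  `|power_profile c x - power_profile c y| <= 1 * abs_pow (x - y).
Proof.
rewrite mul1r; case: c => [b|] /=; last exact: abs_pow_dist.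
rewrite -opprD normrN; apply: le_trans (abs_pow_dist _ _) _; apply: abs_pow_le.
apply: le_trans (min0_dist _ _) _; case: b => //.
by rewrite -opprD normrN.
Qed.

(** For each x exactly one sign loses, so together the signs lose [abs_pow x] with weight th/2,
    against the gain 1 - th off the support. *)
Lemma power_profile_mean (th x : R) :
  \sum_c colour_prob th c * power_profile c x = (1 - 3 / 2 * th) * abs_pow x.
Proof.
rewrite big_option_bool /=.
have -> : abs_pow (Num.min (- x) 0) = abs_pow x - abs_pow (Num.min x 0).
  have [x0|x0] := leP 0 x.
    rewrite (min_idPl _); last by rewrite oppr_le0.
    by rewrite abs_powN abs_pow0 subr0.
  rewrite (min_idPr _); last by rewrite oppr_ge0 ltW.
  by rewrite subrr abs_pow0.
by field.
Qed.

End PowerProfile.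

Section CountingProfile.
Context {R : realType}.
Variable r : R.
Hypothesis r0 : 0 < r.

(* A Lipschitz minorant of the contributions of a coordinate to the l_0 count. *)
Definition counting_profile (c : option bool) (x : R) : R :=
  if c is Some b then Num.min 1 (Num.max (if b then x else - x) 0 / r) - 1
  else Num.min 1 (`|x| / r).

Lemma min1_dist (x y : R) : `|Num.min 1 x - Num.min 1 y| <= `|x - y|.
Proof.
have h1 := ler_norm (x - y); have h2 := ler_norm (- (x - y)); rewrite normrN in h2.
by rewrite /Num.min; case: ltP => hx; case: ltP => hy; rewrite ler_norml; lra.
Qed.

Lemma max0_dist (x y : R) : `|Num.max x 0 - Num.max y 0| <= `|x - y|.
Proof.
have h1 := ler_norm (x - y); have h2 := ler_norm (- (x - y)); rewrite normrN in h2.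
by rewrite /Num.max; case: ltP => hx; case: ltP => hy; rewrite ler_norml; lra.
Qed.

Lemma counting_profile_dist c x y :
  `|counting_profile c x - counting_profile c y| <= r^-1 * `|x - y|.
Proof.
have K (u v : R) : `|u - v| <= `|x - y| -> `|Num.min 1 (u / r) - Num.min 1 (v / r)| <= r^-1 * `|x - y|.
  move=> h; apply: le_trans (min1_dist _ _) _.
  rewrite -mulrBl normrM normfV (gtr0_norm r0) mulrC ler_wpM2l// invr_ge0; exact: ltW.
case: c => [b|] /=; last by apply: K; exact: ler_dist_dist.
rewrite opprB addrA subrK; apply: K; apply: le_trans (max0_dist _ _) _.
by case: b => //; rewrite -opprD normrN.
Qed.

Lemma counting_profile_range c x :
  if c is Some _ then -1 <= counting_profile c x <= 0 else 0 <= counting_profile c x <= 1.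
Proof.
have K (u : R) : 0 <= u -> 0 <= Num.min 1 (u / r) <= 1.
  by move=> u0; rewrite le_min ler01 divr_ge0 ?(ltW r0)//= ge_min lexx.
case: c => [b|] /=; last exact: K.
have h : 0 <= Num.max (if b then x else - x) 0 by rewrite le_max lexx orbT.
by have := K _ h => /andP[]; lra.
Qed.

(** Beyond the radius the minorant takes its extreme values, so its mean there is exactly 1 - th -
    th/2. *)
Lemma counting_profile_big c x : r < `|x| ->
  counting_profile c x = if c is Some b then (if b == (0 < x) then 0 else -1) else 1.
Proof.
move=> rx.
have K (u : R) : r < u -> Num.min 1 (u / r) = 1.
  by move=> h; apply/min_idPl; rewrite ler_pdivlMr// mul1r ltW.
case: c => [b|] /=; last exact: K.
have [x0|x0] := ltP 0 x; case: b => /=.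
- by rewrite (max_idPl (ltW x0)) K ?subrr//; rewrite gtr0_norm in rx.
- by rewrite (max_idPr _) ?oppr_le0 ?(ltW x0)// mul0r (min_idPr _)// sub0r.
- by rewrite (max_idPr x0) mul0r (min_idPr _)// sub0r.
- by rewrite (max_idPl _) ?oppr_ge0// K ?subrr//; rewrite ler0_norm in rx.
Qed.

End CountingProfile.

(** * Choice of constants for p > 0 and for p = 0 *)

Section Instances.
Context {R : realType}.
Variables (p rho rho' rho1 eps th : R).
Hypotheses (th0 : 0 <= th) (mu0 : 0 < 1 - 3 / 2 * th).
Hypothesis rho_th : rho' < th.
Hypotheses (eps0 : 0 < eps) (eps1 : eps <= 1) (rho1_ge0 : 0 <= rho1)
  (rho_rho1 : rho <= rho1) (rho1_rho' : rho1 * (1 + eps) <= rho').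

Let mu : R := 1 - 3 / 2 * th.
(** As mu <= 1, small coordinates then use up at most half of the gain [a], in both cases. *)
Let kap : R := mu / 4.
Let r := spread_radius kap.

Let mu1 : mu <= 1. Proof. by have := th0; rewrite /mu; lra. Qed.
Let th01 : 0 <= th <= 1. Proof. by have := mu0; rewrite th0/=; lra. Qed.
Let kap0 : 0 < kap. Proof. by rewrite divr_gt0. Qed.
Let kap1 : kap < 1. Proof. by have := mu1; rewrite /kap; lra. Qed.
Let r0 : 0 < r. Proof. exact: spread_radius_gt0. Qed.
Let r1 : r <= 1. Proof. exact: spread_radius_le1. Qed.

Lemma sparse_recovery_gt0 : 0 < p -> p < 1 ->
  recovers_fixed_sign_pattern p rho.
Proof.
move=> p0 p1; have p1' := ltW p1.
pose f := @abs_pow R p.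
have f0 := @abs_pow0 R p p0.
have fge := @abs_pow_ge0 R p.
have rp0 : 0 < r `^ p by rewrite powR_gt0.
have rp1 : r `^ p <= 1.
  apply: (@le_trans _ _ (1 `^ p)); last by rewrite powR1.
  by rewrite ge0_ler_powR ?nnegrE ?(ltW p0) ?(ltW r0).
(* With t^p = D and nu = 2 D, 4 nu is half of the gain mu r^p. *)
pose D := mu * r `^ p / 16.
have D0 : 0 < D by rewrite divr_gt0// mulr_gt0.
have D1 : D <= 1.
  have : mu * r `^ p <= 1 by apply: mulr_ile1; rewrite ?(ltW rp0) ?(ltW mu0).
  by rewrite /D; lra.
pose t := D `^ p^-1.
have t0 : 0 < t by rewrite powR_gt0.
have tp : t `^ p = D by rewrite -powRrM mulVf ?gt_eqF// powRr1// ltW.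
have t1 : t <= 1.
  apply: (@le_trans _ _ (1 `^ p^-1)); last by rewrite powR1.
  by rewrite ge0_ler_powR ?nnegrE ?invr_ge0 ?(ltW p0) ?(ltW D0).
have nu0 : 0 < 2 * D by rewrite mulr_gt0.
have a0 : 0 <= mu * r `^ p by rewrite mulr_ge0 ?ltW.
have profN b x : power_profile p (Some b) (- x) = power_profile p (Some (~~ b)) x.
  by case: b => /=; rewrite ?opprK.
have cont c : continuous (power_profile p c).
  apply: (@continuous_of_abs_pow_dist R p p0 _ 1) => // x y.
  exact: power_profile_dist.
have le b x : power_profile p (Some b) x <= power_profile p None x.
  by apply: (@le_trans _ _ 0); rewrite /= ?oppr_le0.
have lip c x y : `|power_profile p c x - power_profile p c y| <=
    2 * D / 2 * (1 + ((x - y) / t) ^+ 2).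
  apply: le_trans (power_profile_dist p0 p1' c x y) _.
  rewrite mul1r; apply: le_trans (abs_pow_scale p0 p1' _ t0) _.
  by rewrite tp (_ : 2 * D / 2 = D)//; field.
have sqr c x : power_profile p c x ^+ 2 <= 1 + x ^+ 2.
  case: c => [b|] /=; last exact: abs_pow_sqr.
  rewrite sqrrN; apply: le_trans (abs_pow_sqr p0 p1' _) _.
  rewrite lerD2l -[leLHS]real_normK ?num_real// -[leRHS]real_normK ?num_real//.
  apply: lerXn2r; rewrite ?nnegrE//; apply: le_trans (min0_norm _) _.
  by case: b; rewrite ?normrN.
have meanb x : - 0 <= \sum_c colour_prob th c * power_profile p c x.
  by rewrite power_profile_mean// oppr0 mulr_ge0// ltW.
have meana x : r < `|x| -> mu * r `^ p <= \sum_c colour_prob th c * power_profile p c x.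
  move=> rx; rewrite power_profile_mean// ler_wpM2l ?(ltW mu0)//.
  by rewrite ge0_ler_powR ?nnegrE ?(ltW p0) ?(ltW r0) ?(ltW rx).
have hnu : 4 * (2 * D) <= mu * r `^ p - (mu * r `^ p + 0) * kap.
  rewrite addr0 /D; have : mu * r `^ p * kap <= mu * r `^ p * (1 / 2).
    by rewrite ler_wpM2l//; have := mu1; rewrite /kap; lra.
  by lra.
apply: (@sparse_recovery R (power_profile p) f (abs_pow p) _ _ _ _
  th rho rho' rho1 eps kap (2 * D) t (mu * r `^ p) 0 p) => //.
- by move=> s s0; rewrite powR_gt0// normr_gt0 gt_eqF.
- by move=> s z s0; rewrite /= abs_powM// /f f0 subr0.
- move=> s x z s0 x0 /=.
  have -> : Num.min (s * z) 0 = s * Num.min z 0.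
    by rewrite minr_pMr ?mulr0 // ltW.
  rewrite abs_powM// -mulrN ler_wpM2l// /f.
  have [z0|z0] := ltP z 0.
    have := abs_powD p0 p1' (x + z) (- z); rewrite addrK abs_powN; lra.
  rewrite f0 oppr0 subr_ge0; apply: abs_pow_le => //.
  by rewrite !ger0_norm ?lerDl ?addr_ge0 ?(ltW x0).
- move=> s x z s0 x0 /=.
  have -> : Num.min (- (s * z)) 0 = s * Num.min (- z) 0.
    by rewrite minr_pMr ?mulr0 ?mulrN // ltW.
  rewrite abs_powM// -mulrN ler_wpM2l// /f.
  have [z0|z0] := ltP (- z) 0.
    have := abs_powD p0 p1' (x + z) (- z); rewrite addrK abs_powN; lra.
  rewrite f0 oppr0 subr_ge0; apply: abs_pow_le => //.
  by rewrite -normrN -[leRHS]normrN !ger0_norm; lra.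
- by move=> n v; rewrite /lp_pow gt_eqF.
Qed.

Lemma sparse_recovery_0 : p = 0 ->
  recovers_fixed_sign_pattern p rho.
Proof.
move=> pz; have /andP[tha thb] := th01; have mule1 := mu1; have mugt0 := mu0.
pose H := counting_profile r.
pose f (x : R) : R := (x != 0)%:R.
(* The profile is Lipschitz with constant 1/r, so nu = t/r = mu/8 and 4 nu is half of the gain
   mu. *)
pose t := r * mu / 8.
have t0 : 0 < t by rewrite divr_gt0// mulr_gt0.
have t1 : t <= 1.
  have : r * mu <= 1 by apply: mulr_ile1; rewrite ?(ltW r0) ?(ltW mu0).
  by rewrite /t; lra.
have nuE : t / r = mu / 8 by rewrite /t; field; rewrite gt_eqF.
have range c x := counting_profile_range r0 c x.
have HN b x : H (Some b) (- x) = H (Some (~~ b)) x.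
  by rewrite /H /=; case: b => /=; rewrite ?opprK.
have cont c : continuous (H c).
  apply: (@continuous_of_abs_pow_dist R 1 ltr01 _ r^-1); first by rewrite invr_gt0.
  by move=> x y; rewrite /abs_pow powRr1//; exact: counting_profile_dist.
have le b x : H (Some b) x <= H None x.
  by have := range (Some b) x; have := range None x => /= /andP[h1 _] /andP[_ h2];
    exact: le_trans h1.
have lip c x y : `|H c x - H c y| <= t / r / 2 * (1 + ((x - y) / t) ^+ 2).
  apply: le_trans (counting_profile_dist r0 c x y) _.
  set q := x - y.
  (* Arithmetic-geometric mean inequality: |q|/t <= (1 + (q/t)^2)/2. *)
  have h : 0 <= (`|q| / t - 1) ^+ 2 * (t / r / 2).
    by rewrite mulr_ge0 ?sqr_ge0// divr_ge0// divr_ge0// ltW.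
  have E : (q / t) ^+ 2 = (`|q| / t) ^+ 2 by rewrite !expr_div_n real_normK ?num_real.
  rewrite E -subr_ge0; move: h; congr (_ <= _); field.
  by rewrite !gt_eqF.
have sqr c x : H c x ^+ 2 <= 1 + x ^+ 2.
  apply: (@le_trans _ _ 1); last by rewrite lerDl sqr_ge0.
  rewrite -real_normK ?num_real//; apply: exprn_ile1 => //.
  rewrite ler_norml; have := range c x; rewrite -/H.
  by case: c => [b|] /andP[]; lra.
have meanb x : - 1 <= \sum_c colour_prob th c * H c x.
  rewrite big_option_bool /colour_prob.
  have /andP[h1 _] := range None x.
  have /andP[h2 _] := range (Some true) x.
  have /andP[h3 _] := range (Some false) x.
  have g1 : 0 <= (1 - th) * H None x by rewrite mulr_ge0//; lra.
  have g2 : th / 2 * (-1) <= th / 2 * H (Some true) x by rewrite ler_wpM2l//; lra.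
  have g3 : th / 2 * (-1) <= th / 2 * H (Some false) x by rewrite ler_wpM2l//; lra.
  by lra.
have meana x : r < `|x| -> mu <= \sum_c colour_prob th c * H c x.
  move=> rx; rewrite big_option_bool /H !counting_profile_big//.
  by rewrite /colour_prob /mu; case: (0 < x) => /=; lra.
have hnu : 4 * (t / r) <= mu - (mu + 1) * kap.
  rewrite nuE /kap; have : mu * mu <= mu by rewrite ler_piMl// ltW.
  by have := mu0; rewrite -/mu; lra.
have nu0 : 0 < t / r by rewrite divr_gt0.
have mu0' : 0 <= mu by exact: ltW.
have big0 c x : H c x <= 1.
  by have := range c x; rewrite -/H; case: c => [b|] /andP[]; lra.
apply: (@sparse_recovery R H f (fun=> 1) _ _ _ _
  th rho rho' rho1 eps kap (t / r) t mu 1 p) => //.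
- move=> s z s0; rewrite mul1r /f eqxx subr0.
  have [->|z0] := eqVneq z 0; last exact: big0.
  by rewrite mulr0 /H /= normr0 mul0r ge_min lexx orbT.
- move=> s x z s0 x0; rewrite mul1r /f (gt_eqF x0) /=.
  have /andP[_ h2] := range (Some true) (s * z).
  have [xz|_] /= := eqVneq (x + z) 0; last by rewrite subrr.
  have z0 : z <= 0 by lra.
  rewrite /H /= (max_idPr _); last by rewrite mulr_ge0_le0// ltW.
  by rewrite mul0r (min_idPr ler01).
- move=> s x z s0 x0; rewrite mul1r /f (lt_eqF x0) /=.
  have /andP[_ h2] := range (Some false) (s * z).
  have [xz|_] /= := eqVneq (x + z) 0; last by rewrite subrr.
  have z0 : 0 <= z by lra.
  rewrite /H /= (max_idPr _); last by rewrite oppr_le0 mulr_ge0// ltW.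
  by rewrite mul0r (min_idPr ler01).
- move=> n v; rewrite /lp_pow pz eqxx -sum1_card natr_sum [LHS]big_mkcond/=.
  apply: eq_bigr => j _; rewrite /f; case: (boolP (v j 0 != 0)) => h.
    by rewrite mem_set.
  by rewrite memNset//=; exact/negP.
Qed.

End Instances.

Theorem theorem6 (R : realType) (p rho : R) :
  0 <= p -> p < 1 -> rho < 2 / 3 ->
  exists c7 c8 : R, [/\ 0 < c7, c7 < 1 & 0 < c8] /\
  exists N : nat, forall m n : nat, (N <= n)%N ->
    c7 < m%:R / n%:R ->
    forall (T : {set 'I_n}) (sigma : 'I_n -> R),
      #|T|%:R <= rho * m%:R ->
      (forall i, i \in T -> sigma i = 1 \/ sigma i = -1) ->
    forall (d : measure_display) (Omega : measurableType d)
           (P : probability Omega R) (G : 'I_m * 'I_n -> Omega -> R),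
      mutually_independent P G ->
      (forall k, std_gaussian P (G k)) ->
      exists E : set Omega, measurable E /\
        ((1 - expR (- (c8 * n%:R)))%:E <= P E)%E /\
        forall w, E w ->
          forall x : 'cV[R]_n,
            (forall i, x i 0 != 0 <-> i \in T) ->
            (forall i, i \in T -> Num.sg (x i 0) = sigma i) ->
            unique_lp_minimizer p (gauss_matrix G w) x.
Proof.
move=> p0 p1 rho23.
(* Raising [rho] to at least 1/2 allows the division that defines [eps] and makes [eps] at most 1.
   Then [rho1], [rho'], [th] increase strictly below 2/3, leaving room for the aspect ratio, for
   random colour counts and for a positive mean. *)
pose rho1 := Num.max rho (1 / 2).
pose rho' := (rho1 + 2 / 3) / 2.
pose th := (rho' + 2 / 3) / 2.
have r1 : rho1 < 2 / 3 by rewrite gt_max rho23/=; lra.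
have r12 : 1 / 2 <= rho1 by rewrite le_max lexx orbT.
have rr1 : rho <= rho1 by rewrite le_max lexx.
pose eps := (rho' - rho1) / rho1.
have rho1_gt0 : 0 < rho1 by lra.
have eps0 : 0 < eps by rewrite divr_gt0// /rho'; lra.
have eps1 : eps <= 1 by rewrite ler_pdivrMr// /rho'; lra.
have hr : rho1 * (1 + eps) <= rho'.
  by rewrite mulrDr mulr1 /eps [rho1 * _]mulrC divfK ?gt_eqF//; lra.
have th0 : 0 <= th by rewrite /th /rho'; lra.
have mu0 : 0 < 1 - 3 / 2 * th by rewrite /th /rho'; lra.
have rth : rho' < th by rewrite /th /rho'; lra.
have [pz|pn] := eqVneq p 0.
  exact: (sparse_recovery_0 th0 mu0 rth eps0 eps1 (ltW rho1_gt0) rr1 hr pz).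
have pp : 0 < p by rewrite lt_neqAle eq_sym pn.
exact: (sparse_recovery_gt0 th0 mu0 rth eps0 eps1 (ltW rho1_gt0) rr1 hr pp p1).
Qed.
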